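(* Let $D\ge1$ and let $\lambda\in\mathscr Q^{[D]}$ be a possibly disconnected skew Ferrers diagram of size $D$ (up to translation). Then there is an identity $$\mathsf{FZ}_\lambda(q)=T_\lambda.F^{[D]}(\vec y;q)\Big|_{\vec y=1}$$ in $\mathbb Z[[q]]$.
   Context: Diagrams. A Ferrers diagram is a finite subset $\lambda\subset\mathbb N^2$ ($\mathbb N\ni0$) closed downwards for the componentwise order; its size $|\lambda|$ is its cardinality. Elements are drawn as unit boxes in English notation ($x$-axis left to right, $y$-axis top to bottom), so rows are the parts of a partition. A skew Ferrers diagram is a set-theoretic difference of two Ferrers diagrams; its connected components are taken with respect to boxes sharing an edge. Two skew Ferrers diagrams are equivalent up to translation if there is a bijection between their connected components such that corresponding components differ by a translation by a vector of $\mathbb Z^2$ (depending on the component). $\mathscr Q^{[D]}$ is the set of equivalence classes of skew Ferrers diagrams of size $D$, and $\mathscr Q=\coprod_D\mathscr Q^{[D]}$. The series $\mathsf{FZ}_\lambda$. For $\lambda\in\mathscr Q^{[D]}$ let $A_n(\lambda)$ be the number of ways to add $\lambda$ to all partitions of size $n$, i.e. the number of pairs of Ferrers diagrams $\mu\subset\mu'$ with $|\mu|=n$, $|\mu'|=n+D$ and $\mu'\smallsetminus\mu$ equivalent to $\lambda$. Put $\mathsf{FZ}_\lambda(q)=\sum_{n\ge0}A_n(\lambda)q^n$. Operators, connected case. Let $\lambda$ be connected. The north-west path of $\lambda$ is the path along the boundary of $\lambda$ from its north-easternmost point to its south-westernmost point whose first step goes west; it consists of $\ell_1$ steps west, then $v_1$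 steps south, ..., then $\ell_M$ steps west, then $v_M$ steps south, with all $\ell_i,v_i\ge1$. Put $L=L(\lambda)=\sum_{i=1}^M\ell_i$. For formal variables $y_{j,h}$, $(j,h)\in\mathbb N\times\mathbb N$, and $j\ge0$ set $$S_{[j,j+L-1]}=\prod_{k=1}^M\left[\left(\frac{\mathrm d}{\mathrm dy_{j+\sum_{i=k+1}^M\ell_i,\,v_k}}-\delta_{k<M}\frac{\mathrm d}{\mathrm dy_{j+\sum_{i=k+1}^M\ell_i,\,v_k+1}}\right)\prod_{p=0}^{\ell_k-2}\frac{\mathrm d}{\mathrm dy_{j+\sum_{i=k}^M\ell_i-p-1,\,0}}\right],$$ where $\delta_{k<M}$ is $1$ if $k<M$ and $0$ otherwise, and empty sums are $0$, empty products $1$. Then $T_\lambda=\sum_{j\ge0}S_{[j,j+L-1]}$. Operators, general case. If $\lambda$ has connected components $\lambda^{(1)},\ldots,\lambda^{(N)}$, let $S^{(i)}_I$ be the summand of $T_{\lambda^{(i)}}$ indexed by the interval $I=[j,j+L(\lambda^{(i)})-1]\subset\mathbb N$, and $$T_\lambda=\frac1{\prod_{\rho\in\mathscr Q}\mathfrak s_\rho(\lambda)!}\sum_{(I^{(1)},\ldots,I^{(N)})}S^{(1)}_{I^{(1)}}\cdots S^{(N)}_{I^{(N)}},$$ the sum being over $N$-tuples of pairwise disjoint intervals $I^{(h)}\subset\mathbb N$ of $L(\lambda^{(h)})$ consecutive integers, and $\mathfrak s_\rho(\lambda)$ the number of connected components of $\lambda$ equal to $\rho$ up to translation. Partition function.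 The $D$-decorated partition function is $$F^{[D]}(\vec y;q)=\Big(\prod_{k=1}^Dy_{0,k}\Big)\prod_{j\ge1}\Big(y_{j,0}+y_{j,1}q^j+y_{j,1}y_{j,2}q^{2j}+\cdots+\Big(\prod_{k=1}^Dy_{j,k}\Big)\sum_{m_j\ge D}q^{jm_j}\Big).$$ Each summand of $T_\lambda$ is a finite polynomial in derivatives and acts on the finitely many factors of $F^{[D]}$ containing the relevant variables; $|_{\vec y=1}$ means setting all variables equal to $1$ after differentiation, and the resulting sum over $j$ (or over interval tuples) is taken in $\mathbb Z[[q]]$. *)

(* Defs.v *)
From HB Require Import structures.
From mathcomp Require Export all_boot all_order all_algebra finmap.
From mathcomp Require Export mpoly.
From mathcomp Require Export boolp classical_sets cardinality.

Set Implicit Arguments.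
Unset Strict Implicit.
Unset Printing Implicit Defensive.

Import GRing.Theory.

Local Open Scope fset_scope.
Local Open Scope ring_scope.

Record fps (R : Type) := Fps { coefs : nat -> R }.

HB.instance Definition _ (R : Type) := gen_eqMixin (fps R).
HB.instance Definition _ (R : Type) := gen_choiceMixin (fps R).

Lemma fpsP (R : Type) (a b : fps R) : coefs a =1 coefs b -> a = b.
Proof. by case: a b => [a] [b] /= /funext ->. Qed.

Section FpsRing.
Variable R : comNzRingType.
Implicit Types a b c : fps R.

Definition fps0 : fps R := Fps (fun=> 0).
Definition fpsC (x : R) : fps R := Fps (fun n => if n is 0%N then x else 0).
Definition fps_opp a : fps R := Fps (fun n => - coefs a n).
Definition fps_add a b : fps R := Fps (fun n => coefs a n + coefs b n).
Definition fps_mul a b : fps R :=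
  Fps (fun n => \sum_(i < n.+1) coefs a i * coefs b (n - i)%N).

Fact fps_addA : associative fps_add.
Proof. by move=> a b c; apply: fpsP => n /=; rewrite addrA. Qed.
Fact fps_addC : commutative fps_add.
Proof. by move=> a b; apply: fpsP => n /=; rewrite addrC. Qed.
Fact fps_add0 : left_id fps0 fps_add.
Proof. by move=> a; apply: fpsP => n /=; rewrite add0r. Qed.
Fact fps_addN : left_inverse fps0 fps_opp fps_add.
Proof. by move=> a; apply: fpsP => n /=; rewrite addNr. Qed.

HB.instance Definition _ :=
  GRing.isZmodule.Build (fps R) fps_addA fps_addC fps_add0 fps_addN.

Let trunc m a : {poly R} := \poly_(i < m.+1) coefs a i.

Let coef_trunc m a n : (n <= m)%N -> (trunc m a)`_n = coefs a n.
Proof. by move=> le_nm; rewrite coef_poly ltnS le_nm. Qed.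

Let coef_truncM m a b n :
  (n <= m)%N -> (trunc m a * trunc m b)`_n = coefs (fps_mul a b) n.
Proof.
move=> le_nm; rewrite coefM; apply: eq_bigr => i _.
by rewrite !coef_trunc// (leq_trans _ le_nm)// ?leq_subr// -ltnS.
Qed.

Fact fps_mulA : associative fps_mul.
Proof.
move=> a b c; apply: fpsP => n.
transitivity ((trunc n a * (trunc n b * trunc n c))`_n).
  rewrite coefM /=; apply: eq_bigr => i _.
  by rewrite coef_truncM ?leq_subr// coef_trunc// -ltnS.
rewrite mulrA coefM /=; apply: eq_bigr => i _.
by rewrite coef_truncM ?coef_trunc ?leq_subr// -ltnS.
Qed.

Fact fps_mulC : commutative fps_mul.
Proof.
move=> a b; apply: fpsP => n.
by rewrite -(@coef_truncM n)// mulrC coef_truncM.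
Qed.

Fact fps_mul1 : left_id (fpsC 1) fps_mul.
Proof.
move=> a; apply: fpsP => n; rewrite /= big_ord_recl /= mul1r subn0.
by rewrite big1 ?addr0// => i _; rewrite mul0r.
Qed.

Fact fps_mulD : left_distributive fps_mul fps_add.
Proof.
move=> a b c; apply: fpsP => n /=; rewrite -big_split /=.
by apply: eq_bigr => i _; rewrite mulrDl.
Qed.

Fact fps_1_neq0 : fpsC 1 != 0 :> fps R.
Proof.
by apply/eqP => /(congr1 (fun a => coefs a 0%N)) /= /eqP; rewrite oner_eq0.
Qed.

HB.instance Definition _ := GRing.Zmodule_isComNzRing.Build (fps R)
  fps_mulA fps_mulC fps_mul1 fps_mulD fps_1_neq0.

(* q-adic convergence, the coefficients being discrete. *)
Definition fps_cvg (u : nat -> fps R) (l : fps R) : Prop :=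
  forall n, exists J0, forall J, (J0 <= J)%N -> coefs (u J) n = coefs l n.

(* The family g, restricted to the indices satisfying P, is summable with
   sum s: for every n only finitely many members contribute to q^n. *)
Definition fps_has_sum (T : choiceType) (P : T -> Prop) (g : T -> fps R)
    (s : fps R) : Prop :=
  forall n, exists X : {fset T},
    [/\ forall t, t \in X -> P t,
        forall t, P t -> t \notin X -> coefs (g t) n = 0
      & coefs s n = \sum_(t <- X) coefs (g t) n].

End FpsRing.

Definition fps_map (R S : Type) (f : R -> S) (a : fps R) : fps S :=
  Fps (fun n => f (coefs a n)).

(* The box (x, y) is the square [x, x+1] * [y, y+1], with y pointing south. *)
Definition box := (nat * nat)%type.

Definition ferrers (mu : {fset box}) : Prop :=
  forall b c : box, c \in mu -> (b.1 <= c.1)%N -> (b.2 <= c.2)%N -> b \in mu.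

Definition skew_ferrers (la : {fset box}) : Prop :=
  exists mu nu, [/\ ferrers mu, ferrers nu & la = mu `\` nu].

Definition share_edge (b c : box) : bool :=
  ((b.1 == c.1) && ((b.2 == c.2.+1) || (c.2 == b.2.+1))) ||
  ((b.2 == c.2) && ((b.1 == c.1.+1) || (c.1 == b.1.+1))).

Definition component (la : {fset box}) (b : la) : {fset box} :=
  [fset val c | c : la &
    connect (fun u v : la => share_edge (val u) (val v)) b c].

Definition components (la : {fset box}) : {fset {fset box}} :=
  [fset component b | b : la].

Definition translates (C C' : {fset box}) : Prop :=
  exists t : int * int,
    [fset (b.1%:Z + t.1, b.2%:Z + t.2) | b in C]
      = [fset (b.1%:Z, b.2%:Z) | b in C'].

Definition skew_equiv (la la' : {fset box}) : Prop :=
  exists2 f : components la -> components la', bijective f &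
    forall C, translates (val C) (val (f C)).

Definition additions (la : {fset box}) (n : nat) : set ({fset box} * {fset box}) :=
  [set m | [/\ ferrers m.1 /\ ferrers m.2, (m.1 `<=` m.2)%fset,
               #|` m.1|%fset = n, #|` m.2|%fset = (n + #|` la|%fset)%N
             & skew_equiv (m.2 `\` m.1)%fset la]]%classic.

(* This set is finite: a diagram of size m lies in a grid of side m. *)
Definition A_ (n : nat) (la : {fset box}) : nat :=
  #|` fset_set (additions la n)|.

Definition FZ (la : {fset box}) : fps int := Fps (fun n => (A_ n la)%:Z).

Definition is_ne_point (C : {fset box}) (p : nat * nat) : Prop :=
  (exists2 b, b \in C & p = (b.1.+1, b.2)) /\
  (forall b, b \in C -> (b.1.+1 <= p.1)%N /\ (p.2 <= b.2)%N).

Definition is_sw_point (C : {fset box}) (p : nat * nat) : Prop :=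
  (exists2 b, b \in C & p = (b.1, b.2.+1)) /\
  (forall b, b \in C -> (p.1 <= b.1)%N /\ (b.2.+1 <= p.2)%N).

(* The unit edge from (x, y) to (x+1, y) (resp. (x, y+1)) lies on the boundary
   of C iff exactly one of the two boxes that it separates belongs to C. *)
Definition hboundary (C : {fset box}) (x y : nat) : bool :=
  ((x, y) \in C) (+) (if y is y'.+1 then (x, y') \in C else false).

Definition vboundary (C : {fset box}) (x y : nat) : bool :=
  ((x, y) \in C) (+) (if x is x'.+1 then (x', y) \in C else false).

(* From p, the steps s (true: west, false: south) follow the boundary to p'. *)
Fixpoint boundary_walk (C : {fset box}) (p : nat * nat) (s : seq bool)
    (p' : nat * nat) : bool :=
  match s with
  | [::] => p == p'
  | true :: s' =>
      if p.1 is x.+1 then hboundary C x p.2 && boundary_walk C (x, p.2) s' p'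
      else false
  | false :: s' =>
      vboundary C p.1 p.2 && boundary_walk C (p.1, p.2.+1) s' p'
  end.

(* w = [:: (l_1, v_1); ...; (l_M, v_M)] *)
Definition steps (w : seq (nat * nat)) : seq bool :=
  flatten [seq nseq lv.1 true ++ nseq lv.2 false | lv <- w].

Definition is_nw_path (C : {fset box}) (w : seq (nat * nat)) : Prop :=
  (forall lv, lv \in w -> (1 <= lv.1)%N /\ (1 <= lv.2)%N) /\
  (exists p p', [/\ is_ne_point C p, is_sw_point C p'
                  & boundary_walk C p (steps w) p']).

(* The north-west path; [::] if there is none, which does not happen for the
   connected components of a skew Ferrers diagram. *)
Definition nw_path (C : {fset box}) : seq (nat * nat) :=
  xget [::] [set w | is_nw_path C w]%classic.

Definition width (C : {fset box}) : nat := \sum_(lv <- nw_path C) lv.1.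

(* The variables y_{j,h} are cut off at j, h <= J; everything below is used only
   in the limit J -> oo, so the value of inord beyond the cut-off is
   irrelevant. Polynomials in the y_{j,h} and (constant-coefficient)
   polynomials in the d/dy_{j,h} are both encoded in ypoly J, the latter with
   the indeterminate number yidx J j h standing for d/dy_{j,h}. *)
Definition ypoly (J : nat) := {mpoly (fps rat)[J.+1 * J.+1]}.

Definition yidx (J j h : nat) : 'I_(J.+1 * J.+1) :=
  mxvec_index (inord j : 'I_J.+1) (inord h : 'I_J.+1).

Definition y_ (J j h : nat) : ypoly J := 'X_(yidx J j h).
Definition d_ (J j h : nat) : ypoly J := 'X_(yidx J j h).

Definition dapply (J : nat) (T f : ypoly J) : ypoly J :=
  \sum_(m <- msupp T) T@_m *: mderivm m f.

Definition at_one (J : nat) (f : ypoly J) : fps rat := f.@[fun=> 1].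

(* S_{[j, j+L-1]} for the path w; k runs over 0, ..., M-1, so that
   tl k = l_{k+1} + ... + l_M in the 1-based numbering of w. *)
Definition S_ (J : nat) (w : seq (nat * nat)) (j : nat) : ypoly J :=
  let M := size w in
  let l k := (nth (0, 0)%N w k).1 in
  let v k := (nth (0, 0)%N w k).2 in
  let tl k := (\sum_(k <= i < M) l i)%N in
  \prod_(k < M)
    ((d_ J (j + tl k.+1) (v k)
        - (k.+1 < M)%N%:R * d_ J (j + tl k.+1) (v k).+1)
     * \prod_(p < (l k).-1) d_ J (j + tl k - p - 1) 0).

Definition interval (a L : nat) : {fset nat} := [fset i in iota a L].

Section Tla.
Variable la : {fset box}.

(* A tuple of intervals, one for each component C, is given by the tuple of
   their left ends. *)
Definition disjoint_intervals (a : {ffun components la -> nat}) : Prop :=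
  forall C C', C != C' ->
    [disjoint interval (a C) (width (val C))
            & interval (a C') (width (val C'))]%fset.

(* The product of s_rho(la)! over rho: the blocks of the partition are the
   nonempty sets of components equal to a given rho up to translation. *)
Definition symmetry_factor : nat :=
  (\prod_(B in equivalence_partition
             (fun C C' : components la => `[< translates (val C) (val C') >])
             [set: components la]%SET) (#|B|)`!)%N.

Definition T_summand (J : nat) (a : {ffun components la -> nat}) : ypoly J :=
  fpsC (symmetry_factor%:R^-1)
    *: \prod_(C : components la) S_ J (nw_path (val C)) (a C).

End Tla.

(* \sum_(m >= D) q^(j m), for j >= 1 *)
Definition qtail (D j : nat) : fps rat :=
  Fps (fun n => ((j %| n) && (D * j <= n))%N%:R).

Definition qpow (n : nat) : fps rat := Fps (fun i => (i == n)%:R).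

(* The partial product of F^[D], over the factors with index at most J. *)
Definition F_ (D J : nat) : ypoly J :=
  (\prod_(1 <= k < D.+1) y_ J 0 k) *
  \prod_(1 <= j < J.+1)
    (y_ J j 0
     + \sum_(1 <= m < D) qpow (j * m) *: \prod_(1 <= k < m.+1) y_ J j k
     + qtail D j *: \prod_(1 <= k < D.+1) y_ J j k).

(* z = T_la . F^[D] at y = 1: every summand of T_la has a value at y = 1, and
   these values form a summable family with sum z. *)
Definition TF_at_one (D : nat) (la : {fset box}) (z : fps rat) : Prop :=
  exists2 g : {ffun components la -> nat} -> fps rat,
    forall a, disjoint_intervals a ->
      fps_cvg (fun J => at_one (dapply (T_summand J a) (F_ D J))) (g a)
    & fps_has_sum (@disjoint_intervals la) g z.

(* Main.v *)
From mathcomp Require Import perm action.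
From mathcomp Require Import zify.
Require Import Defs.
From mathcomp Require ssrcomplements.

Set Implicit Arguments.
Unset Strict Implicit.
Unset Printing Implicit Defensive.

Import GRing.Theory.

(** A summand of T_la, given by the tuple [a] of the left ends of its intervals,
counts partitions. The factor of index j of F^[D] is the generating series of
the multiplicity m_j of the part j, its variables recording how large m_j is:
at y = 1 the derivative by y_(j,0) selects m_j = 0, the one by y_(j,v) selects
m_j >= v, and the difference for v and v + 1 selects m_j = v
([at_one_column_op_factor]). As the intervals are disjoint, every factor is
differentiated at most once, so the value at y = 1 is again a product over j
([dapply_prod]). It is 1/s times, s being the symmetry factor, the generating
series of the partitions mu whose multiplicities obey these constraints at the
columns of the intervals ([coefs_T_summand]).

The multiplicity m_x is the number of vertical steps of the boundary of mu at
abscissa x. The constraints therefore say that the boundary of mu contains a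
translate of the north-west path of every component C, starting at column
[a C]; at the south-west end of the path the boundary may go on southwards,
hence an inequality there. Under these constraints, lengthening the columns of
mu by those of the components gives a diagram mu', and the components of
mu' minus mu are exactly the translated ones ([filled_equiv]). Indeed a skew
diagram is the region between two nonincreasing functions t and u, and its
components are its maximal runs of columns with t x < u (x + 1)
([component_strip]).

Conversely an addition of la to mu, together with a matching of the components
of la with those of mu' minus mu, is recovered from the left ends of the
matched components ([left_ends_fits], [left_ends_fills]). Two matchings differ
by a permutation of the components of la inside their translation classes, so
each addition comes from s tuples ([fiber_card], [card_class_perms]), and
summing over the tuples cancels the factor 1/s ([sum_fits_count]).

The operators are written in terms of the north-west path. It exists because it
follows the tops of the columns ([walk_exists]). It is unique because two boxes
of a connected skew diagram never touch at a corner only ([no_pinch]), so that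
a walk along the boundary never meets a branching. *)

(** * Applying polynomials in the derivatives *)

Section DifferentialOperators.
Local Open Scope ring_scope.

Section Dapply.
Variable J : nat.
Implicit Types T f g : ypoly J.

(** Summing over all monomials of bounded degree instead of the support makes
linearity in the operator visible, since the support of a sum is not determined
by the supports. *)
Lemma dapplywE k T f : (msize T <= k)%N ->
  dapply T f = \sum_(m : 'X_{1..(J.+1 * J.+1) < k}) T@_m *: mderivm m f.
Proof.
move=> le_k; rewrite /dapply.
pose I := 'X_{1..(J.+1 * J.+1) < k}.
rewrite (ssrcomplements.big_mksub I) /=; first last.
- by move=> m /msize_mdeg_lt /leq_trans; apply.
- exact: msupp_uniq.
rewrite big_rmcond //= => m.
by move/memN_msupp_eq0 => ->; rewrite scale0r.
Qed.

Lemma dapplyD T1 T2 f : dapply (T1 + T2) f = dapply T1 f + dapply T2 f.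
Proof.
pose k := maxn (msize (T1 + T2)) (maxn (msize T1) (msize T2)).
rewrite !(@dapplywE k) ?leq_max ?leqnn ?orbT //.
by rewrite -big_split /=; apply: eq_bigr => m _; rewrite mcoeffD scalerDl.
Qed.

Lemma dapplyZ c T f : dapply (c *: T) f = c *: dapply T f.
Proof.
pose k := maxn (msize (c *: T)) (msize T).
rewrite !(@dapplywE k) ?leq_max ?leqnn ?orbT //.
by rewrite scaler_sumr; apply: eq_bigr => m _; rewrite mcoeffZ scalerA.
Qed.

Lemma dapply0 f : dapply 0 f = 0.
Proof. by rewrite -[X in dapply X](scale0r 0) dapplyZ scale0r. Qed.

Lemma dapplyX m f : dapply 'X_[m] f = mderivm m f.
Proof. by rewrite /dapply msuppX big_seq1 mcoeffX eqxx scale1r. Qed.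

Lemma dapplyU i f : dapply 'X_i f = mderiv i f.
Proof. by rewrite dapplyX mderivmU1m. Qed.

Lemma dapply1 f : dapply 1 f = f.
Proof. by rewrite -mpolyX0 dapplyX mderivm0m. Qed.

Lemma dapplyZr T c f : dapply T (c *: f) = c *: dapply T f.
Proof.
rewrite /dapply scaler_sumr; apply: eq_bigr => m _.
by rewrite mderivmZ !scalerA mulrC.
Qed.

Lemma dapply0r T : dapply T 0 = 0.
Proof. by rewrite -[X in dapply _ X](scale0r 0) dapplyZr scale0r. Qed.

(** Derivatives commute and compose by adding exponents, so the encoding of
operators by polynomials is multiplicative. *)
Lemma dapplyM T1 T2 f : dapply (T1 * T2) f = dapply T1 (dapply T2 f).
Proof.
elim/mpolyind: T1 => [|c m T1 _ _ IH]; first by rewrite mul0r !dapply0.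
rewrite mulrDl !dapplyD IH -scalerAl !dapplyZ dapplyX; congr (_ *: _ + _).
elim/mpolyind: T2 {IH} => [|c' m' T2 _ _ IH].
  by rewrite mulr0 !dapply0 -dapplyX dapply0r.
rewrite mulrDr !dapplyD IH mderivmD -scalerAr !dapplyZ mderivmZ.
by rewrite -mpolyXD addmC !dapplyX mderivmDm.
Qed.

End Dapply.

End DifferentialOperators.

(** * The factors of the decorated partition function *)

Section ColumnFactors.
Local Open Scope ring_scope.

Section Leibniz.
Variable J : nat.
Implicit Types T f g : ypoly J.

Definition derivation T : Prop :=
  forall f g, dapply T (f * g) = dapply T f * g + f * dapply T g.

Lemma derivation1 T : derivation T -> dapply T 1 = 0.
Proof.
move=> /(_ 1 1); rewrite !mulr1 mul1r => /(congr1 (fun z => z - dapply T 1)).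
by rewrite subrr addrK.
Qed.

Lemma derivation_prod_eq0 (K : seq nat) (P : pred nat) (H : nat -> ypoly J) T :
  derivation T -> (forall j, j \in K -> P j -> dapply T (H j) = 0) ->
  dapply T (\prod_(j <- K | P j) H j) = 0.
Proof.
move=> dT H0; rewrite big_seq_cond.
elim/big_ind: _ => [|f g f0 g0|j /andP[jK Pj]]; first exact: derivation1.
  by rewrite dT f0 g0 mul0r mulr0 addr0.
exact: H0.
Qed.

(** If a derivation kills all factors but one, only one term of the Leibniz rule
survives. *)
Lemma derivation_prod (K : seq nat) (H : nat -> ypoly J) T x :
  derivation T -> uniq K -> x \in K ->
  (forall j, j \in K -> j != x -> dapply T (H j) = 0) ->
  dapply T (\prod_(j <- K) H j)
    = \prod_(j <- K) (if j == x then dapply T (H j) else H j).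
Proof.
move=> dT uK xK H0; rewrite !(bigD1_seq x) //= eqxx dT.
rewrite [X in _ + _ * X]derivation_prod_eq0 // mulr0 addr0; congr (_ * _).
by apply: eq_bigr => j /negbTE ->.
Qed.

(** Each operator [o p] only sees the factor of index [col p]. In the Leibniz
rule for a later operator, the factors that have already been differentiated
are still killed unless their index is the right one, because the operators
commute. *)
Lemma dapply_prod (I : eqType) (s : seq I) (col : I -> nat) (o : I -> ypoly J)
    (K : seq nat) (G : nat -> ypoly J) :
  uniq K -> (forall p, p \in s -> col p \in K) ->
  (forall p, p \in s -> derivation (o p)) ->
  (forall p j, p \in s -> j \in K -> j != col p -> dapply (o p) (G j) = 0) ->
  dapply (\prod_(p <- s) o p) (\prod_(j <- K) G j)
    = \prod_(j <- K) dapply (\prod_(p <- s | col p == j) o p) (G j).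
Proof.
move=> uK; elim: s => [|p s IH] sK ds G0.
  by rewrite big_nil dapply1; apply: eq_bigr => j _; rewrite big_nil dapply1.
rewrite big_cons dapplyM IH; first last.
- by move=> q j qs; apply: G0; rewrite inE qs orbT.
- by move=> q qs; apply: ds; rewrite inE qs orbT.
- by move=> q qs; apply: sK; rewrite inE qs orbT.
rewrite (derivation_prod (x := col p)) //; first last.
- move=> j jK jp; rewrite -dapplyM mulrC dapplyM G0 ?dapply0r //.
  by rewrite inE eqxx.
- by apply: sK; rewrite inE eqxx.
- by apply: ds; rewrite inE eqxx.
apply: eq_bigr => j _; rewrite big_cons eq_sym.
by case: ifP => // _; rewrite dapplyM.
Qed.

Lemma derivationU i : derivation ('X_i : ypoly J).
Proof. by move=> f g; rewrite !dapplyU mderivM. Qed.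

Lemma derivationB T1 T2 : derivation T1 -> derivation T2 -> derivation (T1 - T2).
Proof.
move=> d1 d2 f g; rewrite -scaleN1r !dapplyD !dapplyZ d1 d2 !scaleN1r.
by rewrite mulrDl mulrDr mulNr mulrN opprD addrACA.
Qed.

End Leibniz.

Lemma at_oneD J (f g : ypoly J) : at_one (f + g) = at_one f + at_one g.
Proof. exact: mevalD. Qed.
Lemma at_oneM J (f g : ypoly J) : at_one (f * g) = at_one f * at_one g.
Proof. exact: mevalM. Qed.
Lemma at_oneZ J c (f : ypoly J) : at_one (c *: f) = c * at_one f.
Proof. exact: mevalZ. Qed.
Lemma at_one0 J : at_one (0 : ypoly J) = 0.
Proof. exact: meval0. Qed.
Lemma at_one1 J : at_one (1 : ypoly J) = 1.
Proof. exact: meval1. Qed.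
Lemma at_one_sum J (I : Type) (r : seq I) (P : pred I) (F : I -> ypoly J) :
  at_one (\sum_(i <- r | P i) F i) = \sum_(i <- r | P i) at_one (F i).
Proof. exact: (big_morph _ (@at_oneD J) (@at_one0 J)). Qed.
Lemma at_one_prod J (I : Type) (r : seq I) (P : pred I) (F : I -> ypoly J) :
  at_one (\prod_(i <- r | P i) F i) = \prod_(i <- r | P i) at_one (F i).
Proof. exact: (big_morph _ (@at_oneM J) (@at_one1 J)). Qed.
Lemma at_oney J j k : at_one (y_ J j k) = 1.
Proof. exact: mevalXU. Qed.

Lemma coefsD (a b : fps rat) n : coefs (a + b) n = coefs a n + coefs b n.
Proof. by []. Qed.
Lemma coefsB (a b : fps rat) n : coefs (a - b) n = coefs a n - coefs b n.
Proof. by []. Qed.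
Lemma coefs_sum (I : Type) (r : seq I) (P : pred I) (F : I -> fps rat) n :
  coefs (\sum_(i <- r | P i) F i) n = \sum_(i <- r | P i) coefs (F i) n.
Proof. exact: (big_morph (fun a : fps rat => coefs a n)). Qed.
Lemma coefsM (a b : fps rat) n :
  coefs (a * b) n = \sum_(i < n.+1) coefs a i * coefs b (n - i).
Proof. by []. Qed.
Lemma coefs1 n : coefs (1 : fps rat) n = (n == 0)%:R.
Proof. by case: n. Qed.
Lemma coefsCM c (a : fps rat) n : coefs (fpsC c * a) n = c * coefs a n.
Proof.
rewrite coefsM big_ord_recl /= subn0 big1 ?addr0 // => i _.
by rewrite mul0r.
Qed.
Lemma coefsM_nat (a : fps rat) (b : bool) n :
  coefs (a * b%:R) n = coefs a n * b%:R.
Proof. by case: b; rewrite ?mulr1 ?mulr0. Qed.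

Section Factor.
Variables D J : nat.
Hypothesis hD : (1 <= D)%N.
Hypothesis hDJ : (D <= J)%N.

(** The factor of index 0 corresponds to the part 0, which has infinite
multiplicity: only its last monomial is present. *)
Definition factor (j : nat) : ypoly J :=
  if j == 0%N then \prod_(1 <= k < D.+1) y_ J 0 k else
    y_ J j 0
     + \sum_(1 <= m < D) qpow (j * m) *: \prod_(1 <= k < m.+1) y_ J j k
     + qtail D j *: \prod_(1 <= k < D.+1) y_ J j k.

Lemma F_factor : F_ D J = \prod_(j <- iota 0 J.+1) factor j.
Proof.
rewrite /F_ /= big_cons; congr (_ * _).
rewrite /index_iota subSS subn0 big_seq [RHS]big_seq.
by apply: eq_bigr => j; rewrite mem_iota /factor; case: j.
Qed.

Lemma yidx_inj i v j k : (i <= J)%N -> (v <= J)%N -> (j <= J)%N -> (k <= J)%N ->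
  (yidx J i v == yidx J j k) = (i == j) && (v == k).
Proof.
move=> iJ vJ jJ kJ; apply/eqP/andP => [|[/eqP -> /eqP ->]] // e.
have [/(congr1 val) + /(congr1 val)] := enum_rank_inj (cast_ord_inj e).
by rewrite /= !inordK ?ltnS // => -> ->.
Qed.

Lemma mderiv_y i v j k : (i <= J)%N -> (v <= J)%N -> (j <= J)%N -> (k <= J)%N ->
  mderiv (yidx J i v) (y_ J j k) = ((i == j) && (v == k))%:R.
Proof.
move=> iJ vJ jJ kJ; rewrite /y_ mderivX mnm1E eq_sym yidx_inj //.
case: andP => [[/eqP -> /eqP ->]|_]; last by rewrite scale0r.
by rewrite scale1r -mpolyX0; congr 'X_[_]; apply/mnmP => l; rewrite mnmBE mnm0E subnn.
Qed.

Lemma mderiv_col i v j m : (i <= J)%N -> (v <= J)%N -> (j <= J)%N -> (m <= J)%N ->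
  i != j -> mderiv (yidx J i v) (\prod_(1 <= k < m.+1) y_ J j k) = 0.
Proof.
move=> iJ vJ jJ mJ ij; rewrite -dapplyU.
apply: (derivation_prod_eq0 (@derivationU _ _)) => k.
rewrite mem_index_iota => kJ _; rewrite dapplyU mderiv_y ?(negbTE ij) //; lia.
Qed.

Lemma at_one_col j m : at_one (\prod_(1 <= k < m.+1) y_ J j k) = 1.
Proof. by rewrite at_one_prod big1 // => k _; rewrite at_oney. Qed.

Lemma at_one_mderiv_col v j m : (v <= J)%N -> (j <= J)%N -> (m <= J)%N ->
  at_one (mderiv (yidx J j v) (\prod_(1 <= k < m.+1) y_ J j k))
    = (1 <= v <= m)%N%:R.
Proof.
move=> vJ jJ; elim: m => [|m IH] mJ.
  rewrite big_geq // -mpolyC1 mderivC at_one0; case: v vJ => [|v] //=.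
rewrite big_nat_recr //= mderivM at_oneD !at_oneM IH; last by lia.
rewrite at_one_col at_oney mulr1 mul1r mderiv_y // eqxx /=.
case: (eqVneq v m.+1) => [->|vm]; first by rewrite ltnn andbF at_one1 add0r leqnn.
by rewrite at_one0 addr0; congr (_%:R); lia.
Qed.

(** The generating series of the multiplicity m of the part j, restricted to the
m satisfying M: the sum of the q^(j m). *)
Definition part_series (j : nat) (M : pred nat) : fps rat :=
  Fps (fun n => ((j %| n) && M (n %/ j))%N%:R).

Lemma eq_part_series j (M M' : pred nat) : M =1 M' -> part_series j M = part_series j M'.
Proof. by move=> e; apply: fpsP => n /=; rewrite e. Qed.

Lemma part_seriesB j (M M' : pred nat) : (forall m, M' m -> M m) ->
  part_series j M - part_series j M' = part_series j (fun m => M m && ~~ M' m).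
Proof.
move=> sM; apply: fpsP => n; rewrite coefsB /=.
case: (j %| n)%N; rewrite ?subrr //=.
by have := sM (n %/ j)%N; case: (M' _) => [->|_] //; rewrite ?subrr // subr0 andbT.
Qed.

Lemma coefs_truncated (j n : nat) (b : pred nat) : (0 < j)%N ->
  coefs (\sum_(1 <= m < D) qpow (j * m) * (b m)%:R) n
    = ((j %| n) && (1 <= n %/ j < D) && b (n %/ j))%N%:R.
Proof.
move=> j0; rewrite coefs_sum.
under eq_bigr => m _ do rewrite coefsM_nat /=.
case: (boolP (j %| n)%N) => [/dvdnP[q ->]|jn] /=; last first.
  rewrite big1 // => m _; case: eqP => [e|_]; last by rewrite mul0r.
  by case/negP: jn; rewrite e dvdn_mulr.
rewrite mulnK //.
have qm m : (q * j == j * m)%N = (m == q) by rewrite mulnC eqn_pmul2l // eq_sym.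
under eq_bigr => m _ do rewrite qm.
case: (boolP (1 <= q < D)%N) => hq /=.
  rewrite (bigD1_seq q) ?iota_uniq ?mem_index_iota //= eqxx mul1r big1 ?addr0 //.
  by move=> m /negbTE ->; rewrite mul0r.
rewrite big_seq big1 // => m; rewrite mem_index_iota => hm.
by case: eqP => [e|_]; rewrite ?mul0r //; rewrite e (negbTE hq) in hm.
Qed.

(** The multiplicities m >= D share one monomial in the y's, so a condition on m
can be read off from the factor only if it does not distinguish them. *)
Lemma at_one_factor_comb (j : nat) (c : bool) (b : pred nat) : (0 < j)%N ->
  (forall m, (D <= m)%N -> b m = b D) ->
  c%:R + \sum_(1 <= m < D) qpow (j * m) * (b m)%:R + qtail D j * (b D)%:R
  = part_series j (fun m => if m == 0%N then c else b m).
Proof.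
move=> j0 hb; apply: fpsP => n; rewrite !coefsD coefs_truncated // coefsM_nat /=.
have -> : coefs (c%:R : fps rat) n = (c && (n == 0%N))%:R.
  by case: c; rewrite ?coefs1.
case: (boolP (j %| n)%N) => [/dvdnP[q ->]|jn] /=; last first.
  by rewrite mul0r !addr0; case: eqP => [e|]; rewrite ?andbF //; rewrite e dvdn0 in jn.
rewrite mulnK // muln_eq0 (gtn_eqF j0) orbF leq_pmul2r //.
case: (ltnP q D) => qD /=; rewrite ?mul0r ?addr0.
  by case: q qD => [|q] qD /=; rewrite ?eqxx ?andbT ?andbF ?addr0 ?add0r.
case: q qD => [|q] qD /=; first by lia.
by rewrite andbF !add0r mul1r (hb q.+1).
Qed.

Lemma at_one_factor j : (j <= J)%N ->
  at_one (factor j) = if j == 0%N then 1 else part_series j predT.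
Proof.
move=> jJ; rewrite /factor; case: eqP => [_|/eqP j0]; first exact: at_one_col.
rewrite !at_oneD at_oney at_one_sum at_oneZ at_one_col.
under eq_bigr => m _ do rewrite at_oneZ at_one_col.
have := @at_one_factor_comb j true predT; rewrite lt0n => -> //.
by apply: eq_part_series => m; case: eqP.
Qed.

Lemma mderiv_factor_eq0 i v j : (i <= J)%N -> (v <= J)%N -> (j <= J)%N ->
  i != j -> mderiv (yidx J i v) (factor j) = 0.
Proof.
move=> iJ vJ jJ ij; rewrite /factor; case: (eqVneq j 0%N) => [j0|j0].
  by subst j; rewrite mderiv_col.
rewrite !mderivD mderiv_y // (negbTE ij) add0r mderivZ mderiv_col // scaler0 addr0.
rewrite raddf_sum big_seq big1 // => m; rewrite mem_index_iota => hm.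
by rewrite /= mderivZ mderiv_col ?scaler0 //; lia.
Qed.

Lemma at_one_mderiv_factor v j : (v <= D)%N -> (j <= J)%N ->
  at_one (mderiv (yidx J j v) (factor j)) =
    if j == 0%N then (1 <= v)%N%:R
    else part_series j (fun m => if v == 0%N then m == 0%N else (v <= m)%N).
Proof.
move=> vD jJ; have vJ := leq_trans vD hDJ; rewrite /factor; case: eqP => [j0|/eqP j0].
  by subst j; rewrite at_one_mderiv_col // vD andbT.
rewrite !mderivD mderiv_y // eqxx /= !at_oneD mderivZ at_oneZ at_one_mderiv_col //.
rewrite raddf_sum at_one_sum big_seq.
under eq_bigr => m hm.
  rewrite /= mderivZ at_oneZ at_one_mderiv_col //; last first.
    by move: hm; rewrite mem_index_iota; lia.
over.
rewrite -big_seq.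
have -> : at_one ((v == 0%N)%:R : ypoly J) = (v == 0%N)%:R.
  by case: (v == 0%N); rewrite ?at_one1 ?at_one0.
rewrite (@at_one_factor_comb j (v == 0%N) (fun m => (1 <= v <= m)%N)) ?lt0n //;
  last by lia.
by apply: eq_part_series => m; case: (v) => [|w]; case: m => [|m] //=.
Qed.

(** The operator of a single column, where the path makes v vertical steps. Only
at its leftmost column may the boundary of the partition go on southwards, so
only there is no upper bound on the multiplicity imposed. *)
Definition column_op (x v : nat) (leftmost : bool) : ypoly J :=
  if v == 0%N then d_ J x 0 else
  if leftmost then d_ J x v else d_ J x v - d_ J x v.+1.

Lemma derivation_column_op x v b : derivation (column_op x v b).
Proof.
rewrite /column_op; case: ifP => _; first exact: derivationU.
by case: b; last apply: derivationB; apply: derivationU.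
Qed.

Lemma column_op_factor_eq0 x v b j :
  (x <= J)%N -> (v + ~~ b <= D)%N -> (j <= J)%N -> j != x ->
  dapply (column_op x v b) (factor j) = 0.
Proof.
move=> xJ vD jJ; rewrite eq_sym => xj; rewrite /column_op.
case: eqP => _; first by rewrite dapplyU mderiv_factor_eq0.
case: b vD => /= vD; rewrite -?scaleN1r ?dapplyD ?dapplyZ !dapplyU !mderiv_factor_eq0 //.
all: rewrite ?scaler0 ?addr0 //; lia.
Qed.

(** The bound on v keeps y_(x,v+1) among the variables of the factor: otherwise
the subtracted derivative would vanish and no upper bound on m would result. *)
Lemma at_one_column_op_factor x v (b : bool) : (x <= J)%N -> (v + ~~ b <= D)%N ->
  (b -> 0 < v)%N -> (0 < x + b)%N ->
  at_one (dapply (column_op x v b) (factor x)) =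
    if x == 0%N then 1 else part_series x (fun m => if b then (v <= m)%N else m == v).
Proof.
move=> xJ vD bv xb; rewrite /column_op; case: eqP => [v0|/eqP v0].
  subst v; case: b vD bv xb => [_ /(_ isT)//|_ _ /=]; rewrite addn0 => x0.
  by rewrite dapplyU at_one_mderiv_factor //= gtn_eqF.
case: b vD bv xb => /= vD bv xb.
  rewrite dapplyU at_one_mderiv_factor //; last by lia.
  by rewrite lt0n v0 (negbTE v0).
rewrite -scaleN1r dapplyD dapplyZ !dapplyU at_oneD at_oneZ mulN1r.
rewrite !at_one_mderiv_factor //; try lia.
rewrite gtn_eqF; last by lia.
rewrite (negbTE v0) /= part_seriesB; last by lia.
by apply: eq_part_series => m; lia.
Qed.

End Factor.

End ColumnFactors.

(** * Coefficients of products of series *)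

Section ProductCoefficients.
Local Open Scope ring_scope.

Definition agree_upto (n : nat) (a b : fps rat) : Prop :=
  forall i, (i <= n)%N -> coefs a i = coefs b i.

Lemma agree_prod n (I : Type) (r : seq I) (P : pred I) (F G : I -> fps rat) :
  (forall i, P i -> agree_upto n (F i) (G i)) ->
  agree_upto n (\prod_(i <- r | P i) F i) (\prod_(i <- r | P i) G i).
Proof.
move=> FG; elim/big_rec2: _ => // i a b Pi ab k kn.
rewrite !coefsM; apply: eq_bigr => l _.
by rewrite FG // ?ab //; have := ltn_ord l; lia.
Qed.

Lemma qpow0 : qpow 0 = 1.
Proof. by apply: fpsP => n; rewrite coefs1. Qed.

Lemma qpowD a b : qpow (a + b)%N = qpow a * qpow b.
Proof.
apply: fpsP => n; rewrite coefsM /=.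
case: (leqP a n) => an; last first.
  rewrite big1; first by rewrite ltn_eqF // ltn_addr.
  by move=> i _; rewrite ltn_eqF ?mul0r // (leq_trans _ an) // ltn_ord.
rewrite (bigD1 (Ordinal (an : (a < n.+1)%N))) //= eqxx mul1r big1 ?addr0.
  by congr (_%:R); lia.
move=> i; rewrite -val_eqE /= => /negbTE ->.
by rewrite mul0r.
Qed.

Lemma prod_bool (I : finType) (b : pred I) :
  \prod_i (b i)%:R = [forall i, b i]%:R :> fps rat.
Proof.
case: (boolP [forall i, b i]) => [/forallP h|].
  by rewrite big1 // => i _; rewrite h.
rewrite negb_forall => /existsP[i /negbTE bi].
by rewrite (bigD1 i) //= bi mul0r.
Qed.

Lemma part_series_truncated n j (M : pred nat) : (0 < j)%N ->
  agree_upto n (part_series j M) (\sum_(m < n.+1) qpow (j * m) * (M m)%:R).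
Proof.
move=> j0 i i_n; rewrite coefs_sum.
under eq_bigr => m _ do rewrite coefsM_nat.
rewrite /=.
case: (boolP (j %| i)%N) => [/dvdnP[q qE]|ji] /=; last first.
  rewrite big1 // => m _; case: eqP => [e|_]; last by rewrite mul0r.
  by case/negP: ji; rewrite e dvdn_mulr.
subst i; rewrite mulnK //.
have qn : (q < n.+1)%N by rewrite ltnS (leq_trans _ i_n) // leq_pmulr.
rewrite (bigD1 (Ordinal qn)) //= mulnC eqxx mul1r big1 ?addr0 // => m.
rewrite -val_eqE /= eqn_pmul2l // eq_sym => /negbTE ->.
by rewrite mul0r.
Qed.

(** The product of the series of all parts j = 1, ..., J is a sum over families
of multiplicities; those contributing to q^n are bounded by n. *)
Lemma coefs_prod_part_series J n (M : nat -> pred nat) :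
  coefs (\prod_(j <- iota 0 J.+1) (if j == 0%N then 1 else part_series j (M j))) n
  = #|[set m : {ffun 'I_J -> 'I_n.+1} |
       (\sum_(j < J) j.+1 * m j == n)%N && [forall j : 'I_J, M j.+1 (m j)]]|%:R.
Proof.
rewrite /= big_cons mul1r (iotaDl 1 0) big_map -{1}[J]subn0 big_mkord.
under eq_bigr => j _ do rewrite add1n /=.
rewrite (@agree_prod n _ _ _ _ _
  (fun (j : 'I_J) _ => @part_series_truncated n j.+1 (M j.+1) isT)) //.
rewrite bigA_distr_bigA /= coefs_sum.
rewrite -sum1_card natr_sum [RHS]big_mkcond /=; apply: eq_bigr => f _.
rewrite big_split prod_bool coefsM_nat inE.
rewrite -(big_morph qpow qpowD qpow0) /= [n == _]eq_sym.
by case: eqP; rewrite ?mul0r // mul1r /=; case: ifP.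
Qed.

End ProductCoefficients.

(** * North-west paths of connected skew diagrams *)

Section NorthWestPath.
Local Open Scope fset_scope.
Local Open Scope nat_scope.

Lemma nonincreasing_le (f : nat -> nat) (hf : forall x, f x.+1 <= f x) x y :
  x <= y -> f y <= f x.
Proof.
move=> /subnKC <-; elim: (y - x) => [|k IH]; first by rewrite addn0.
by rewrite addnS (leq_trans (hf _)).
Qed.

Definition corners_ok (w : seq (nat * nat)) : Prop :=
  forall lv, lv \in w -> 1 <= lv.1 /\ 1 <= lv.2.

(** The numbers of vertical steps of the path at its successive columns, from
right to left: each of the l west steps of a block but the last is followed by
no south step. *)
Definition col_mults (w : seq (nat * nat)) : seq nat :=
  flatten [seq rcons (nseq lv.1.-1 0) lv.2 | lv <- w].

Lemma corners_ok_cons lv w :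
  corners_ok (lv :: w) -> [/\ 1 <= lv.1, 1 <= lv.2 & corners_ok w].
Proof.
move=> h; have [] := h lv; rewrite ?inE ?eqxx // => h1 h2; split => // x xw.
by apply: h; rewrite inE xw orbT.
Qed.

Lemma size_col_mults w : corners_ok w ->
  size (col_mults w) = \sum_(lv <- w) lv.1.
Proof.
elim: w => [|lv w IH]; first by rewrite big_nil.
move=> /corners_ok_cons[h1 h2 /IH e]; rewrite big_cons -e /col_mults /=.
by rewrite size_cat size_rcons size_nseq; lia.
Qed.

Section Ops.
Local Open Scope ring_scope.
Variable J : nat.

Fixpoint path_ops (j : nat) (es : seq nat) : ypoly J :=
  if es is e :: es' then column_op J (j + size es') e (nilp es') * path_ops j es'
  else 1.

Lemma path_ops_zeros j n es :
  path_ops j (nseq n 0%N ++ es)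
    = (\prod_(p < n) d_ J (j + (size es + n) - p - 1) 0) * path_ops j es.
Proof.
elim: n => [|n IH] /=; first by rewrite big_ord0 mul1r.
rewrite IH big_ord_recl mulrA /column_op eqxx /= size_cat size_nseq; congr (_ * _ * _).
  by congr (d_ J _ 0); lia.
by apply: eq_bigr => p _; congr (d_ J _ 0); rewrite /bump /=; lia.
Qed.

Lemma S_cons j lv w : 
  S_ J (lv :: w) j =
   (d_ J (j + \sum_(x <- w) x.1) lv.2
     - (0 < size w)%N%:R * d_ J (j + \sum_(x <- w) x.1) lv.2.+1)
   * (\prod_(p < lv.1.-1) d_ J (j + (lv.1 + \sum_(x <- w) x.1) - p - 1) 0)
   * S_ J w j.
Proof.
have sumE k : (\sum_(k.+1 <= i < (size w).+1) (nth (0, 0)%N (lv :: w) i).1)%N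
      = (\sum_(k <= i < size w) (nth (0, 0)%N w i).1)%N by rewrite big_add1.
have sum0 : (\sum_(0 <= i < size w) (nth (0, 0)%N w i).1)%N = (\sum_(x <- w) x.1)%N.
  by rewrite [RHS](big_nth (0, 0)%N).
have sumS : (\sum_(0 <= i < (size w).+1) (nth (0, 0)%N (lv :: w) i).1)%N
    = (lv.1 + \sum_(x <- w) x.1)%N.
  by rewrite big_ltn // sumE sum0.
rewrite [LHS]/S_ /= big_ord_recl /=. rewrite sumS !sumE sum0 ltnS; congr (_ * _).
rewrite /S_ /=; apply: eq_bigr => k _.
by rewrite /bump /= !add1n !sumE ltnS.
Qed.

(** The operator of a path is the product of the operators of its columns: the
inner product over p in [S_] handles the columns without vertical step. *)
Lemma S_path_ops j w : corners_ok w -> S_ J w j = path_ops j (col_mults w).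
Proof.
elim: w => [|lv w IH]; first by rewrite /S_ big_ord0.
move=> /corners_ok_cons[h1 h2 hw]; rewrite S_cons IH // /col_mults /= cat_rcons.
rewrite path_ops_zeros /= -/(col_mults w) size_col_mults // mulrA [X in _ = X * _]mulrC.
congr (_ * _ * _).
  rewrite /column_op gtn_eqF // /nilp size_col_mults //.
  case: w hw {IH} => [|lv' w] /=; first by rewrite big_nil addn0 mul0r subr0.
  move=> /corners_ok_cons[h1' _ _]; rewrite big_cons mul1r.
  by rewrite gtn_eqF //; lia.
apply: eq_bigr => p _; congr (d_ J _ 0).
by move: (\sum_(x <- w) x.1)%N => z; lia.
Qed.

Lemma path_opsE j es :
  path_ops j es =
    \prod_(i < size es) column_op J (j + i) (nth 0%N (rev es) i) (i == 0%N :> nat).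
Proof.
elim: es => [|e es IH] /=; first by rewrite big_ord0.
rewrite big_ord_recr /= mulrC rev_cons nth_rcons size_rev ltnn eqxx IH; congr (_ * _).
by apply: eq_bigr => i _; rewrite nth_rcons size_rev ltn_ord.
Qed.

End Ops.

Definition col_steps (es : seq nat) : seq bool :=
  flatten [seq true :: nseq e false | e <- es].

Lemma steps_col_mults w : corners_ok w -> steps w = col_steps (col_mults w).
Proof.
elim: w => [|[l v] w IH] //= /corners_ok_cons[/= h1 _ hw].
rewrite /steps /= -/(steps w) IH // /col_steps /col_mults /= map_cat flatten_cat.
congr (_ ++ _); case: l h1 => // l _ /=.
by elim: l => [|l IHl] /=; [rewrite cats0 | rewrite IHl].
Qed.

Lemma col_steps_inj : injective col_steps.
Proof.
elim=> [|e es IH] [|e' es'] //= [].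
rewrite -/(col_steps es) -/(col_steps es') => h.
suff [-> /IH -> //] : e = e' /\ col_steps es = col_steps es'.
elim: e e' h => [|e IHe] [|e'] //=.
- by rewrite /col_steps; case: (es).
- by rewrite /col_steps; case: (es').
by case=> /IHe[-> ->].
Qed.

(** A sequence of columns can be grouped into blocks of west and south steps as
soon as the path ends with a south step. *)
Lemma col_mults_surj es : 0 < last 0 es ->
  exists2 w, corners_ok w & col_mults w = es.
Proof.
case: es => // e es; elim: es e => [|e' es IH] e /=.
  move=> e0; exists [:: (1, e)] => //.
  by move=> lv; rewrite inE => /eqP ->.
move=> /IH[[//|[l v] w] hw ew].
have [/= h1 h2 hw'] := corners_ok_cons hw.
case: e => [|e].
  exists ((l.+1, v) :: w).
    by move=> lv; rewrite inE => /predU1P[-> //|]; apply: hw'.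
  by rewrite -ew; case: l h1 {hw ew}.
exists ((1, e.+1) :: (l, v) :: w).
  by move=> lv; rewrite inE => /predU1P[-> //|]; apply: hw.
by rewrite -ew.
Qed.

(** The connected skew diagrams: L consecutive columns between the tops t and
the bottoms u, consecutive columns sharing an edge by [strip_link]. The
functions t and u are those of the whole skew diagram, of which C may be only
one component. *)
Record strip (t u : nat -> nat) (a L : nat) (C : {fset box}) : Prop := Strip {
  strip_gt0 : 0 < L;
  strip_mem : forall x y, ((x, y) \in C) = (a <= x < a + L) && (t x <= y < u x);
  strip_top : forall x, t x.+1 <= t x;
  strip_bot : forall x, u x.+1 <= u x;
  strip_col : forall x, a <= x < a + L -> t x < u x;
  strip_link : forall x, a <= x -> x.+1 < a + L -> t x < u x.+1 }.

(** The number of vertical steps of the north-west path at the i-th column. *)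
Definition path_mult (t u : nat -> nat) (a i : nat) : nat :=
  if i is i'.+1 then t (a + i') - t (a + i) else u a - t a.

Lemma iota_rcons k : iota 0 k.+1 = rcons (iota 0 k) k.
Proof. by rewrite -addn1 iotaD cats1. Qed.

Lemma vboundary_left (C : {fset box}) a z :
  (forall x, x < a -> (x, z) \in C = false) -> vboundary C a z = ((a, z) \in C).
Proof. by rewrite /vboundary; case: a => [|a] h; rewrite ?(h a) ?addbF. Qed.

Section Walk.
Variables (t u : nat -> nat) (a L : nat) (C : {fset box}).
Hypothesis hC : strip t u a L C.

Let L0 := strip_gt0 hC.
Let memC := strip_mem hC.
Let htop := strip_top hC.
Let hbot := strip_bot hC.
Let hcol := strip_col hC.
Let hlink := strip_link hC.

Lemma ne_pointE p : is_ne_point C p <-> p = (a + L, t (a + L).-1).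
Proof.
have aL : (a + L).-1.+1 = a + L by lia.
have cL := hcol (x := (a + L).-1); split => [[[b bC ->] hb]|->].
  case: b bC hb => x y /=; rewrite memC => hxy hb.
  have := @nonincreasing_le t htop x (a + L).-1.
  case: (hb ((a + L).-1, t (a + L).-1)); first by rewrite memC; lia.
  by move=> /= h2 h3 h1; congr pair; lia.
split; first by exists ((a + L).-1, t (a + L).-1); rewrite ?memC /= ?aL //; lia.
move=> [x y] /=; rewrite memC => hxy; split; first by lia.
have := @nonincreasing_le t htop x (a + L).-1; lia.
Qed.

Lemma sw_pointE p : is_sw_point C p <-> p = (a, u a).
Proof.
have ca := hcol (x := a); split => [[[b bC ->] hb]|->].
  case: b bC hb => x y /=; rewrite memC => hxy hb.
  have := @nonincreasing_le u hbot a x.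
  case: (hb (a, (u a).-1)); first by rewrite memC; lia.
  by move=> /= h2 h3 h1; congr pair; lia.
split; first by exists (a, (u a).-1); rewrite ?memC /= ?prednK //; lia.
move=> [x y] /=; rewrite memC => hxy; split; first by lia.
have := @nonincreasing_le u hbot a x; lia.
Qed.

Lemma boundary_walk_cat p q s s' r :
  boundary_walk C p s q -> boundary_walk C q s' r -> boundary_walk C p (s ++ s') r.
Proof.
elim: s p => [|[] s IH] p /=; first by move=> /eqP ->.
  by case: p => [[|x] y] //= /andP[-> /IH h] /h.
by move=> /andP[-> /IH h] /h.
Qed.

Lemma boundary_walk_south x y n :
  (forall z, y <= z < y + n -> vboundary C x z) ->
  boundary_walk C (x, y) (nseq n false) (x, y + n).
Proof.
elim: n y => [|n IH] y h /=; first by rewrite addn0.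
rewrite h /=; last by lia.
by rewrite -addSnnS IH // => z hz; apply: h; lia.
Qed.

(** From the top right corner of the k-th column, going west along its top and
then south to the top of the next column on the left, or to the bottom if there
is none, always follows the boundary. *)
Lemma walk_exists k : k < L ->
  boundary_walk C (a + k.+1, t (a + k))
    (col_steps [seq path_mult t u a i | i <- rev (iota 0 k.+1)]) (a, u a).
Proof.
elim: k => [|k IH] kL.
all: rewrite iota_rcons rev_rcons map_cons /col_steps map_cons /= addnS /=.
all: rewrite /hboundary memC.
  have c0 := hcol (x := a); rewrite addn0 cats0.
  apply/andP; split.
    case e: (t a) => [|z]; first by lia.
    by rewrite memC; lia.
  rewrite -{2}(subnKC (n := u a) (m := t a)); last by lia.
  apply: boundary_walk_south => z hz.
  have memF x y : x < a -> (x, y) \in C = false by move=> xa; rewrite memC; lia.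
  have -> : vboundary C a z = ((a, z) \in C).
    by apply: vboundary_left => x; apply: memF.
  by rewrite memC; lia.
have ck := hcol (x := a + k.+1); have lk := hlink (x := a + k).
have tk := htop (a + k); rewrite -addnS in tk.
apply/andP; split.
  case e: (t (a + k.+1)) => [|z]; first by lia.
  by rewrite memC; lia.
apply: (@boundary_walk_cat _ (a + k.+1, t (a + k))); last by apply: IH; lia.
rewrite -[in X in boundary_walk _ _ _ X](subnKC tk).
apply: boundary_walk_south => z hz; rewrite /vboundary memC addnS memC.
rewrite addnS in hz lk ck tk.
by lia.
Qed.

(** The point p is the end of a west step or of a south step along the boundary. *)
Definition entered (p : nat * nat) : bool :=
  hboundary C p.1 p.2 || (if p.2 is y.+1 then vboundary C p.1 y else false).

(** The number of boundary edges at a vertex is even, so if three of them are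
boundary edges then so is the fourth. Then two opposite boxes among the four at
this vertex belong to C and the other two do not, which is impossible: if the
north-west and south-east boxes are in C, monotonicity of t and u forces the
other two in; if the north-east and south-west ones are, the two columns do not
share an edge, contrary to [strip_link]. *)
Lemma no_pinch x y : entered (x.+1, y) ->
  hboundary C x y -> vboundary C x.+1 y -> False.
Proof.
rewrite /entered /hboundary /vboundary /=.
have := htop x; have := hbot x; have := @hlink x.
by case: y => [|y]; rewrite !memC; lia.
Qed.

Lemma boundary_walk_end p s q : boundary_walk C p s q ->
  p.1 = q.1 + count id s /\ q.2 = p.2 + count negb s.
Proof.
elim: s p => [|[] s IH] p /=; first by move=> /eqP ->; lia.
  by case: p => [[|x] y] //= /andP[_ /IH /=]; lia.
by move=> /andP[_ /IH /=]; lia.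
Qed.

(** Walks only go west or south, so a walk cannot return to its end point, and
by [no_pinch] the next step is forced. *)
Lemma boundary_walk_uniq p s s' q : entered p ->
  boundary_walk C p s q -> boundary_walk C p s' q -> s = s'.
Proof.
elim: s s' p => [|b s IH] s' p pin.
  move=> /= /eqP <-; case: s' => // b s' /boundary_walk_end /= [h1 h2].
  by exfalso; case: b h1 h2 => /=; lia.
case: s' => [|b' s'].
  move=> /boundary_walk_end /= [h1 h2] /= /eqP e; subst q; exfalso.
  by case: (b) h1 h2 => /=; lia.
case: p pin => [x y] pin; case: b; case: b' => /=.
- case: x pin => // x pin /andP[h1 w1] /andP[_ w2]; congr cons.
  by apply: IH w1 w2; rewrite /entered /= h1.
- by case: x pin => // x pin /andP[h1 _] /andP[h2 _]; case: (no_pinch pin h1 h2).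
- by case: x pin => // x pin /andP[h1 _] /andP[h2 _]; case: (no_pinch pin h2 h1).
move=> /andP[h1 w1] /andP[_ w2]; congr cons.
by apply: IH w1 w2; rewrite /entered /= h1 orbT.
Qed.

Lemma nw_path_strip : corners_ok (nw_path C) /\
  col_mults (nw_path C) = [seq path_mult t u a i | i <- rev (iota 0 L)].
Proof.
have neP := (ne_pointE (a + L, t (a + L).-1)).2 erefl.
have swP := (sw_pointE (a, u a)).2 erefl.
have LE : L = L.-1.+1 by lia.
have walk : boundary_walk C (a + L, t (a + L).-1)
    (col_steps [seq path_mult t u a i | i <- rev (iota 0 L)]) (a, u a).
  have := @walk_exists L.-1; rewrite -LE (_ : a + L.-1 = (a + L).-1); last by lia.
  by apply; lia.
have : is_nw_path C (nw_path C).
  apply: xgetPex.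
  have [|w hw ew] := @col_mults_surj [seq path_mult t u a i | i <- rev (iota 0 L)].
    rewrite LE /= rev_cons map_rcons last_rcons /= subn_gt0 hcol //; lia.
  exists w; split => //; exists (a + L, t (a + L).-1), (a, u a).
  by split => //; rewrite steps_col_mults // ew.
move=> [hw [p [p' [/ne_pointE -> /sw_pointE -> H]]]]; split => //.
apply: col_steps_inj; rewrite -steps_col_mults //.
case: (nw_path C) hw H => [|[l v] w] hw.
  by move=> /eqP[]; lia.
have [/= l0 _ _] := corners_ok_cons hw.
case: l l0 {hw} => // l _ H.
have eL : rev (iota 0 L) = L.-1 :: rev (iota 0 L.-1).
  by rewrite {1}LE iota_rcons rev_rcons.
rewrite eL /= in walk *; rewrite /col_steps /= in walk *.
have eaL : a + L = (a + L).-1.+1 by lia.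
move: walk; rewrite /steps /= [in X in X -> _]eaL /=.
move=> /andP[h1 w1]; move: H; rewrite /steps /= eaL /= -/(steps w).
move=> /andP[_ w2]; congr cons.
by apply: boundary_walk_uniq w2 w1; rewrite /entered /= h1.
Qed.

Lemma width_strip : width C = L.
Proof.
have [ok e] := nw_path_strip.
by rewrite /width -size_col_mults // e size_map size_rev size_iota.
Qed.

Lemma S_strip J j :
  S_ J (nw_path C) j =
    (\prod_(i < L) column_op J (j + i) (path_mult t u a i) (i == 0 :> nat))%R.
Proof.
have [ok e] := nw_path_strip.
rewrite S_path_ops // path_opsE e size_map size_rev size_iota.
apply: eq_bigr => i _; rewrite -map_rev revK (nth_map 0) ?size_iota //.
by rewrite nth_iota.
Qed.

End Walk.

End NorthWestPath.

(** * Connected components of skew diagrams *)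

Section SkewComponents.
Local Open Scope fset_scope.
Local Open Scope nat_scope.

Definition is_left_col (C : {fset box}) (x : nat) : Prop :=
  (exists y, (x, y) \in C) /\ forall b, b \in C -> x <= b.1.

Definition left_col (C : {fset box}) : nat := xget 0 [set x | is_left_col C x]%classic.

Lemma left_col_strip t u a L C : strip t u a L C -> left_col C = a.
Proof.
move=> hC; have ca := strip_col hC (x := a); have L0 := strip_gt0 hC.
have [] : is_left_col C (left_col C).
  apply: xgetPex; exists a; split.
    by exists (t a); rewrite (strip_mem hC); lia.
  by move=> [x y]; rewrite (strip_mem hC) /=; lia.
move=> [y]; rewrite (strip_mem hC) => h1 /(_ (a, t a)).
by rewrite (strip_mem hC) /=; lia.
Qed.

(** The maximal sequences of columns that are linked to each other: the last two
conditions say that the next column on either side shares no edge. *)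
Record column_run (t u : nat -> nat) (a L : nat) : Prop := ColumnRun {
  column_run_gt0 : 0 < L;
  column_run_col : forall x, a <= x < a + L -> t x < u x;
  column_run_link : forall x, a <= x -> x.+1 < a + L -> t x < u x.+1;
  column_run_left : 0 < a -> u a <= t a.-1;
  column_run_right : u (a + L) <= t (a + L).-1 }.

Lemma column_run_uniq t u a L a' L' x : column_run t u a L -> column_run t u a' L' ->
  a <= x < a + L -> a' <= x < a' + L' -> a = a' /\ L = L'.
Proof.
move=> r r' hx hx'.
have aa : a = a'.
  case: (ltngtP a a') => // aa.
    have := column_run_link r (x := a'.-1); rewrite prednK; last by lia.
    by have := column_run_left r'; lia.
  have := column_run_link r' (x := a.-1); rewrite prednK; last by lia.
  by have := column_run_left r; lia.
subst a'; split=> //.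
have := column_run_right r; have := column_run_right r'.
have := column_run_link r (x := (a + L').-1); have := column_run_link r' (x := (a + L).-1).
case: (ltngtP L L') => // ll; first by rewrite prednK; lia.
by move=> _; rewrite prednK; lia.
Qed.

Section Skew.
Variables (t u : nat -> nat) (la : {fset box}).
Hypothesis htop : forall x, t x.+1 <= t x.
Hypothesis hbot : forall x, u x.+1 <= u x.
Hypothesis mem_la : forall x y, ((x, y) \in la) = (t x <= y < u x).

(** The number of places to the left of x where the diagram is cut between two
consecutive columns. Boxes are connected iff no cut separates them, so this
number labels the components. *)
Definition breaks (x : nat) : nat := \sum_(z < x) (u z.+1 <= t z).

Lemma breaksS x : breaks x.+1 = breaks x + (u x.+1 <= t x).
Proof. by rewrite /breaks big_ord_recr. Qed.

Lemma breaks_mono x y : x <= y -> breaks x <= breaks y.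
Proof.
move=> /subnKC <-; elim: (y - x) => [|k IH]; first by rewrite addn0.
by rewrite addnS breaksS (leq_trans IH) // leq_addr.
Qed.

Let adj : rel la := fun b c => share_edge (val b) (val c).

Definition reach (p q : box) : Prop :=
  exists (hp : p \in la) (hq : q \in la), connect adj [` hp] [` hq].

Lemma share_edgeC b c : share_edge b c = share_edge c b.
Proof. by rewrite /share_edge; lia. Qed.

Lemma adj_sym : connect_sym adj.
Proof. by apply: sym_connect_sym => b c; rewrite /adj share_edgeC. Qed.

Lemma reach_refl p : p \in la -> reach p p.
Proof. by move=> hp; exists hp, hp; apply: connect0. Qed.

Lemma reach_sym p q : reach p q -> reach q p.
Proof. by move=> [hp [hq h]]; exists hq, hp; rewrite adj_sym. Qed.

Lemma reach_trans p q r : reach p q -> reach q r -> reach p r.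
Proof.
move=> [hp [hq h]] [hq' [hr h']]; exists hp, hr.
by apply: connect_trans h _; rewrite (bool_irrelevance hq hq').
Qed.

Lemma reach_step p q : p \in la -> q \in la -> share_edge p q -> reach p q.
Proof. by move=> hp hq e; exists hp, hq; apply: connect1. Qed.

Lemma reach_south x y k : (x, y) \in la -> (x, y + k) \in la -> reach (x, y) (x, y + k).
Proof.
elim: k => [|k IH] h h'; first by rewrite addn0; apply: reach_refl.
have hk : (x, y + k) \in la by move: h h'; rewrite !mem_la; lia.
apply: reach_trans (IH h hk) _; apply: reach_step => //.
by rewrite /share_edge /=; lia.
Qed.

Lemma reach_column x y y' : (x, y) \in la -> (x, y') \in la -> reach (x, y) (x, y').
Proof.
move=> h h'; case: (leqP y y') => [/subnKC e|/ltnW /subnKC e].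
  by rewrite -e in h' *; apply: reach_south.
by apply: reach_sym; rewrite -e in h *; apply: reach_south.
Qed.

(** Move inside the column to its top box, which has a right neighbour because
t x.+1 <= t x < u x.+1, and step to the right. *)
Lemma reach_breaks_le x x' y y' : x <= x' -> breaks x = breaks x' ->
  (x, y) \in la -> (x', y') \in la -> reach (x, y) (x', y').
Proof.
move=> /subnKC <-; move: (x' - x) => k; elim: k x y => [|k IH] x y.
  by rewrite addn0 => _; apply: reach_column.
rewrite -addSnnS => e h h'.
have h1 := @breaks_mono x x.+1 (leqnSn _).
have h2 := @breaks_mono x.+1 (x.+1 + k) (leq_addr _ _).
have lk : t x < u x.+1 by move: h1 h2; rewrite -e breaksS; lia.
have tx := htop x; have ux := hbot x.
have hA : (x, t x) \in la by rewrite mem_la; lia.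
have hB : (x.+1, t x) \in la by rewrite mem_la; lia.
apply: reach_trans (reach_column h hA) _.
apply: (@reach_trans _ (x.+1, t x)); last by apply: IH => //; lia.
by apply: reach_step => //; rewrite /share_edge /=; lia.
Qed.

Lemma mem_component (b : la) c :
  (c \in component b) = (c \in la) && (breaks c.1 == breaks (val b).1).
Proof.
have breaks_adj (p q : la) : adj p q -> breaks (val p).1 = breaks (val q).1.
  case: p => [[x y] /= hp]; case: q => [[x' y'] /= hq].
  rewrite /adj /share_edge /=; move: (hp) (hq); rewrite !mem_la => hp' hq'.
  have := htop x; have := htop x'; have := hbot x; have := hbot x'.
  have := breaksS x; have := breaksS x'.
  case: (ltngtP x x') => xx; last by subst x'.
    by have [e|] := eqVneq x' x.+1; [subst x'|]; lia.
  by have [e|] := eqVneq x x'.+1; [subst x|]; lia.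
apply/idP/andP.
  move=> /imfsetP[d /= hd ->]; split; first exact: valP.
  rewrite inE in hd.
  have := @closed_connect _ adj [pred c | breaks (val c).1 == breaks (val b).1].
  move=> /(_ _ b d hd); rewrite !inE eqxx => <- // p q pq.
  by rewrite !inE (breaks_adj _ _ pq).
case=> hc /eqP e; apply/imfsetP; exists [` hc] => //=; rewrite inE.
case: b e => [[x y] hb] /= e; case: c hc e => x' y' hc /= e.
suff [hp [hq h]] : reach (x, y) (x', y').
  by rewrite (bool_irrelevance hb hp) (bool_irrelevance hc hq).
case: (leqP x x') => xx; first exact: reach_breaks_le.
by apply: reach_sym; apply: reach_breaks_le => //; apply: ltnW.
Qed.

Lemma breaks_unbounded k : exists x, k < breaks x.
Proof.
(* The columns beyond the last box are empty, so each of them adds a cut. *)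
pose N := (\max_(b <- la) b.1).+1.
have hN x : N <= x -> u x.+1 <= t x.
  move=> Nx; have ux := hbot x; apply: leq_trans ux _.
  rewrite leqNgt; apply/negP => tu.
  have h : (x, t x) \in la by rewrite mem_la; lia.
  have hx : x <= \max_(b <- la) b.1.
    exact: (@leq_bigmax_seq _ (enum_fset la) predT (fun b : box => b.1) _ h isT).
  by move: Nx; rewrite /N ltnNge hx.
exists (N + k.+1); elim: k => [|k IH]; first by rewrite addn1 breaksS hN // addn1.
by rewrite addnS breaksS hN ?addn1 ?ltnS // leq_addr.
Qed.

(** The columns of the component are a level set of the nondecreasing function
[breaks], hence an interval. An empty column is cut off on both sides, so it
cannot lie in the same level set as a box. *)
Lemma component_strip (b : la) : exists a L,
  [/\ strip t u a L (component b), column_run t u a L & a <= (val b).1 < a + L].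
Proof.
pose k := breaks (val b).1.
have exa : exists x, breaks x == k by exists (val b).1.
have exb : exists x, k < breaks x by exact: breaks_unbounded.
case: (ex_minnP exa) => a /eqP ak amin; case: (ex_minnP exb) => e ke emin.
have levelE x : (breaks x == k) = (a <= x < e).
  apply/eqP/andP => [xk|[ax xe]].
    split; first by apply: amin; rewrite xk.
    by rewrite ltnNge; apply/negP => /breaks_mono; lia.
  apply/eqP; rewrite eqn_leq -{2}ak breaks_mono // andbT leqNgt.
  by apply/negP => /emin; lia.
have ae : a < e by rewrite ltnNge; apply/negP => /breaks_mono; lia.
have lvl x : a <= x < e -> breaks x = k by rewrite -levelE => /eqP.
have lnk x : a <= x -> x.+1 < e -> t x < u x.+1.
  move=> ax xe; rewrite ltnNge; apply/negP => ut.
  by have := lvl x; have := lvl x.+1; rewrite breaksS ut; lia.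
pose xb := (val b).1.
have hxb : a <= xb < e by rewrite -levelE.
have cb : t xb < u xb.
  by have := valP b; rewrite [val b]surjective_pairing mem_la -/xb; lia.
have col x : a <= x < e -> t x < u x.
  move=> hx; have tx := htop x; have ux := hbot x.
  case: (ltnP x.+1 e) => xe; first by have := lnk x; lia.
  case: (eqVneq x xb) => [-> //|xx].
  by have := lnk x.-1; have := htop x.-1; rewrite prednK; lia.
have aL : a + (e - a) = e by lia.
exists a, (e - a); rewrite aL; split => //; last first.
  split; rewrite ?aL //; first by lia.
    case: a {lnk col aL ae hxb lvl levelE} ak amin => // a ak amin _ /=.
    rewrite leqNgt; apply/negP => lt; have := amin a.
    move: ak; rewrite breaksS [u _ <= _]leqNgt lt addn0 => ->.
    by rewrite eqxx ltnn => /(_ isT).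
  case: e {aL lnk col hxb lvl levelE} ke emin ae => // e ke emin ae /=.
  rewrite leqNgt; apply/negP => lt; have := emin e.
  by move: ke; rewrite breaksS [u _ <= _]leqNgt lt addn0 => ->; rewrite ltnn => /(_ isT).
split; rewrite ?aL //; first by lia.
by move=> x y; rewrite mem_component /= levelE mem_la andbC.
Qed.

Lemma mem_componentsP C : reflect (exists b : la, C = component b) (C \in components la).
Proof.
apply: (iffP idP) => [/imfsetP[b /= _ ->]|[b ->]]; first by exists b.
by apply/imfsetP; exists b.
Qed.

Lemma components_strip C : C \in components la ->
  strip t u (left_col C) (width C) C /\ column_run t u (left_col C) (width C).
Proof.
move=> /mem_componentsP[b ->]; have [a [L [h r _]]] := component_strip b.
by rewrite (left_col_strip h) (width_strip h).
Qed.

Lemma components_cover x : t x < u x ->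
  exists2 C, C \in components la & left_col C <= x < left_col C + width C.
Proof.
move=> xtu; have hb : (x, t x) \in la by rewrite mem_la; lia.
have [a [L [h r hx]]] := component_strip [` hb].
exists (component [` hb]); first by apply/mem_componentsP; exists [` hb].
by rewrite (left_col_strip h) (width_strip h).
Qed.

Lemma components_inj C C' x : C \in components la -> C' \in components la ->
  left_col C <= x < left_col C + width C ->
  left_col C' <= x < left_col C' + width C' -> C = C'.
Proof.
move=> /components_strip[s r] /components_strip[s' r'] hx hx'.
have [e e'] := column_run_uniq r r' hx hx'.
by apply/fsetP => -[p q]; rewrite (strip_mem s) (strip_mem s') e e'.
Qed.

Lemma components_left_col_inj C C' : C \in components la -> C' \in components la ->
  left_col C = left_col C' -> C = C'.
Proof.
move=> hC hC' e; apply: (@components_inj _ _ (left_col C)) => //.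
  by have [s _] := components_strip hC; have := strip_gt0 s; lia.
by have [s _] := components_strip hC'; have := strip_gt0 s; lia.
Qed.

Lemma column_run_component a L : column_run t u a L ->
  exists2 C, C \in components la & left_col C = a /\ width C = L.
Proof.
move=> r; have L0 := column_run_gt0 r.
have [|C hC hx] := @components_cover a; first by apply: (column_run_col r); lia.
exists C => //; have [_ r'] := components_strip hC.
by apply: column_run_uniq r' r hx _; lia.
Qed.

End Skew.

End SkewComponents.

(** * Translation equivalence *)

Section Translations.
Local Open Scope fset_scope.
Local Open Scope nat_scope.

Definition translated (d : int * int) (b c : box) : Prop :=
  (c.1%:Z = b.1%:Z + d.1 /\ c.2%:Z = b.2%:Z + d.2)%R.

Lemma translatesP C C' : translates C C' <-> exists d,
  (forall b, b \in C -> exists2 c, c \in C' & translated d b c) /\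
  (forall c, c \in C' -> exists2 b, b \in C & translated d b c).
Proof.
split=> [[d /fsetP e]|[d [h1 h2]]]; exists d.
  split=> [b bC|c cC].
    have := e (b.1%:Z + d.1, b.2%:Z + d.2)%R.
    rewrite in_imfset // => /esym/imfsetP[c /= cC [e1 e2]].
    by exists c.
  have := e (c.1%:Z, c.2%:Z)%R.
  rewrite [in RHS](in_imfset _ (fun b : box => (b.1%:Z, b.2%:Z)%R)) //.
  by move=> /imfsetP[b /= bC [e1 e2]]; exists b.
apply/fsetP => z; apply/imfsetP/imfsetP => -[b /= bC ->].
  by have [c cC [e1 e2]] := h1 b bC; exists c; rewrite //= e1 e2.
by have [c cC [e1 e2]] := h2 b bC; exists c; rewrite //= e1 e2.
Qed.

Lemma translates_refl C : translates C C.
Proof.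
apply/translatesP; exists (0, 0)%R.
by split=> b bC; exists b => //; split; rewrite addr0.
Qed.

Lemma translates_sym C C' : translates C C' -> translates C' C.
Proof.
move=> /translatesP[d [h1 h2]]; apply/translatesP; exists (- d.1, - d.2)%R.
split=> b bC; [case: (h2 b bC) | case: (h1 b bC)] => c cC [e1 e2]; exists c => //.
  by split; rewrite /= ?e1 ?e2 addrK.
by split; rewrite /= ?e1 ?e2 addrK.
Qed.

Lemma translates_trans C C' C'' :
  translates C C' -> translates C' C'' -> translates C C''.
Proof.
move=> /translatesP[d [h1 h2]] /translatesP[d' [h1' h2']].
apply/translatesP; exists (d.1 + d'.1, d.2 + d'.2)%R; split=> b bC.
  have [c cC [e1 e2]] := h1 b bC; have [c' cC' [e1' e2']] := h1' c cC.
  by exists c' => //; split; rewrite /= ?e1' ?e2' ?e1 ?e2 addrA.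
have [c cC [e1 e2]] := h2' b bC; have [c' cC' [e1' e2']] := h2 c cC.
by exists c' => //; split; rewrite /= ?e1 ?e2 ?e1' ?e2' addrA.
Qed.

Lemma translates_card C C' : translates C C' -> #|` C| = #|` C'|.
Proof.
move=> [d /(congr1 (fun A => #|` A|))].
rewrite !card_imfset //=.
  by case=> [x y] [x' y'] [-> ->].
case=> [x y] [x' y'] [/addIr [->] /addIr [->]] //.
Qed.

(** The natural numbers p and q encode the vertical translation by p - q; the
horizontal one is given by the left ends. *)
Lemma translates_strip t u a L C t' u' a' L' C' :
  strip t u a L C -> strip t' u' a' L' C' ->
  translates C C' <-> L = L' /\ exists p q, forall i, i < L ->
    t (a + i) + p = t' (a' + i) + q /\ u (a + i) + p = u' (a' + i) + q.
Proof.
move=> s s'; have L0 := strip_gt0 s; have L0' := strip_gt0 s'.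
have memC := strip_mem s; have memC' := strip_mem s'.
have col := strip_col s; have col' := strip_col s'.
split.
  move=> /translatesP[[d1 d2] [h1 h2]].
  have fwd x y : a <= x < a + L -> t x <= y < u x ->
      exists x' y', [/\ a' <= x' < a' + L', t' x' <= y' < u' x',
         (x'%:Z)%R = (x%:Z + d1)%R & (y'%:Z)%R = (y%:Z + d2)%R].
    move=> hx hy; have [|[x' y'] cC [/= e1 e2]] := h1 (x, y); first by rewrite memC hx hy.
    by move: cC; rewrite memC' => /andP[]; exists x', y'.
  have bwd x y : a' <= x < a' + L' -> t' x <= y < u' x ->
      exists x' y', [/\ a <= x' < a + L, t x' <= y' < u x',
         (x%:Z)%R = (x'%:Z + d1)%R & (y%:Z)%R = (y'%:Z + d2)%R].
    move=> hx hy; have [|[x' y'] cC [/= e1 e2]] := h2 (x, y).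
      by rewrite memC' hx hy.
    by move: cC; rewrite memC => /andP[]; exists x', y'.
  (* Comparing first and last columns determines the horizontal translation. *)
  have [x1 [y1 [hx1 _ e1 _]]] : exists x' y', [/\ a' <= x' < a' + L', t' x' <= y' < u' x',
         (x'%:Z)%R = (a%:Z + d1)%R & (y'%:Z)%R = ((t a)%:Z + d2)%R].
    by apply: fwd; have := col a; lia.
  have [x2 [y2 [hx2 _ e2 _]]] : exists x' y', [/\ a <= x' < a + L, t x' <= y' < u x',
         (a'%:Z)%R = (x'%:Z + d1)%R & ((t' a')%:Z)%R = (y'%:Z + d2)%R].
    by apply: bwd; have := col' a'; lia.
  have [x3 [y3 [hx3 _ e3 _]]] :=
    fwd (a + L).-1 (t (a + L).-1) ltac:(lia) ltac:(have := col (a + L).-1; lia).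
  have [x4 [y4 [hx4 _ e4 _]]] :=
    bwd (a' + L').-1 (t' (a' + L').-1) ltac:(lia)
      ltac:(have := col' (a' + L').-1; lia).
  have eL : L = L' by lia.
  have ed : (a'%:Z = a%:Z + d1)%R by lia.
  split=> //.
  have key i : i < L -> ((t' (a' + i)%N)%:Z = (t (a + i)%N)%:Z + d2 /\
       (u' (a' + i)%N)%:Z = (u (a + i)%N)%:Z + d2)%R.
    move=> iL; have ci := col (a + i) ltac:(lia); have ci' := col' (a' + i) ltac:(lia).
    have [z1 [w1 [_ hw1 f1 g1]]] := fwd (a + i) (t (a + i)) ltac:(lia) ltac:(lia).
    have [z2 [w2 [_ hw2 f2 g2]]] := fwd (a + i) (u (a + i)).-1 ltac:(lia) ltac:(lia).
    have [z3 [w3 [_ hw3 f3 g3]]] := bwd (a' + i) (t' (a' + i)) ltac:(lia) ltac:(lia).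
    have [z4 [w4 [_ hw4 f4 g4]]] := bwd (a' + i) (u' (a' + i)).-1 ltac:(lia) ltac:(lia).
    have ? : z1 = a' + i by lia.
    have ? : z2 = a' + i by lia.
    have ? : z3 = a + i by lia.
    have ? : z4 = a + i by lia.
    by subst z1 z2 z3 z4; lia.
  by case: (d2) key => k key; [exists k, 0 | exists 0, k.+1] => i /key; lia.
move=> [eL [p [q h]]]; subst L'; apply/translatesP.
exists (a'%:Z - a%:Z, p%:Z - q%:Z)%R; split=> -[x y].
  rewrite memC => /andP[hx hy]; have [] := h (x - a); first by lia.
  rewrite subnKC; last by lia.
  move=> h1 h2; exists (a' + (x - a), y + p - q); last by split=> /=; lia.
  by rewrite memC'; lia.
rewrite memC' => /andP[hx hy]; have [] := h (x - a'); first by lia.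
rewrite [a' + _]subnKC; last by lia.
move=> h1 h2; exists (a + (x - a'), y + q - p); last by split=> /=; lia.
by rewrite memC; lia.
Qed.

Lemma component_sym (la : {fset box}) :
  connect_sym (fun u v : la => share_edge (val u) (val v)).
Proof. by apply: sym_connect_sym => b c; rewrite share_edgeC. Qed.

Lemma component_self (la : {fset box}) (b : la) : val b \in component b.
Proof. by apply/imfsetP; exists b => //=; rewrite inE connect0. Qed.

Lemma component_eq (la : {fset box}) (b c : la) : val c \in component b ->
  component b = component c.
Proof.
move=> /imfsetP[d /= dh /val_inj e]; subst d; rewrite inE in dh.
by apply/fsetP => z; apply/imfsetP/imfsetP => -[d /= dd ->]; exists d => //;
  move: dd; rewrite !inE (same_connect (component_sym (la := la)) dh).
Qed.

Lemma card_components (la : {fset box}) :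
  #|` la| = \sum_(C : components la) #|` val C|.
Proof.
have cP (C : components la) : exists b : la, val C = component b.
  by have /imfsetP[b /= _ ->] := valP C; exists b.
transitivity (\sum_(b : la) \sum_(C : components la) (val b \in val C)).
  rewrite cardfE -sum1_card; apply: eq_bigr => b _.
  have hb : component b \in components la by apply/imfsetP; exists b.
  rewrite (bigD1 [` hb]) //= component_self big1 // => C CC.
  have [c e] := cP C; rewrite e; case: (boolP (_ \in _)) => // /component_eq ec.
  by case/eqP: CC; apply: val_inj; rewrite e ec.
rewrite exchange_big /=; apply: eq_bigr => C _.
have sub : val C `<=` la.
  have [c ->] := cP C; apply/fsubsetP => z /imfsetP[d /= _ ->]; exact: valP.
rewrite -(big_seq_fsetE _ la xpredT (fun b => (b \in val C) : nat)) /=.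
rewrite -big_mkcond /= big_fset_condE card_fset_sum1; congr (\sum_(i <- enum_fset _) 1).
apply/fsetP => z; rewrite !inE /=; case: (boolP (z \in val C)); rewrite ?andbF //.
by move=> /(fsubsetP sub) ->.
Qed.

Lemma skew_equiv_card la la' : skew_equiv la la' -> #|` la| = #|` la'|.
Proof.
move=> [f fb ft]; rewrite !card_components.
rewrite [RHS](reindex f); last exact: onW_bij.
by apply: eq_bigr => C _; apply: translates_card.
Qed.

End Translations.

(** * Permutations preserving equivalence classes *)

Section ClassPreservingPermutations.
Local Open Scope nat_scope.

Section ClassPerms.
Variables (T : finType) (R : rel T).
Hypothesis eqR : equivalence_rel R.

Let P := equivalence_partition R [set: T].

Definition class_perms : {set {perm T}} := [set s : {perm T} | [forall x, R x (s x)]].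

Let Rxx x : R x x. Proof. by have [] := eqR x x x. Qed.

Let Rsym x y : R x y = R y x.
Proof.
have sub a b : R a b -> R b a by move=> h; rewrite -((eqR a b a).2 h).
by apply/idP/idP; apply: sub.
Qed.

Let partP : finset.partition P [set: T].
Proof. by apply: finset.equivalence_partitionP => x y z _ _ _; apply: eqR. Qed.

Let mem_cover x : x \in finset.cover P.
Proof. by rewrite (finset.cover_partition partP) inE. Qed.

Let pblockR x y : (y \in finset.pblock P x) = R x y.
Proof.
by apply: finset.pblock_equivalence_partition; rewrite ?inE // => a b c _ _ _;
  apply: eqR.
Qed.

Let memP B x : B \in P -> x \in B -> B = finset.pblock P x.
Proof. by move=> BP xB; apply/esym/finset.def_pblock => //; case/and3P: partP. Qed.

(** A permutation preserving the classes is the same as a family of permutations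
of the single classes. *)
Lemma card_class_perms : #|class_perms| = \prod_(B in P) (#|B|)`!.
Proof.
pose fam := pfamily (1%g : {perm T}) (mem P) (fun B : {set T} => [pred s | perm_on B s]).
pose psi (s : {perm T}) : {ffun {set T} -> {perm T}} :=
  [ffun B => if B \in P then restr_perm B s else 1%g].
have stab s B : s \in class_perms -> B \in P -> s \in ('N(B | 'P))%g.
  rewrite inE => /forallP hs BP; apply/astabsP => // x.
  rewrite /= apermE; apply/idP/idP => h.
    by rewrite (memP BP h) pblockR Rsym.
  by rewrite (memP BP h) pblockR.
have -> : \prod_(B in P) (#|B|)`! = #|fam|.
  rewrite card_pfamily foldrE big_image /=; apply: eq_bigr => B _.
  by rewrite -card_perm; apply: eq_card.
rewrite -(@card_in_imset _ _ psi (mem class_perms)).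
  apply: eq_card => g; apply/imsetP/pfamilyP.
    move=> [s hs ->]; split.
      apply/supportP => B; rewrite ffunE => /negbTE; rewrite -topredE /= => -> //.
    by move=> B BP; rewrite ffunE BP inE restr_perm_on.
  move=> [/supportP g1 gon].
  have gB B x : B \in P -> (g B x \in B) = (x \in B).
    by move=> BP; apply: perm_closed; have := gon B BP; rewrite inE.
  have pbP x : finset.pblock P x \in P by rewrite finset.pblock_mem.
  have inj : injective (fun x => g (finset.pblock P x) x).
    move=> x y e; have hx := gB (finset.pblock P x) x (pbP x).
    have hy := gB (finset.pblock P y) y (pbP y).
    rewrite !finset.mem_pblock !mem_cover in hx hy.
    have exy : finset.pblock P x = finset.pblock P y.
      by rewrite (memP (pbP x) hx) (memP (pbP y) hy) e.
    by move: e; rewrite exy => /perm_inj.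
  have hs : perm inj \in class_perms.
    rewrite inE; apply/forallP => x; rewrite permE -pblockR gB //.
    by rewrite finset.mem_pblock.
  exists (perm inj) => //; apply/ffunP => B; rewrite ffunE; case: ifP => BP; last first.
    by apply: g1; apply/negbT; apply: BP.
  apply/perm.permP => x; case: (boolP (x \in B)) => xB.
    by rewrite restr_permE ?stab // permE -(memP BP xB).
  have := gon B BP; rewrite inE => /out_perm -> //.
  by rewrite (out_perm (restr_perm_on _ _)).
move=> s s' hs hs' e; apply/perm.permP => x.
have BP : finset.pblock P x \in P by rewrite finset.pblock_mem.
have xB : x \in finset.pblock P x by rewrite finset.mem_pblock.
have := congr1 (fun f : {ffun {set T} -> {perm T}} => f (finset.pblock P x) x) e.
by rewrite !ffunE BP !restr_permE ?stab.
Qed.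

End ClassPerms.

End ClassPreservingPermutations.

(** * Column heights and multiplicities of parts *)

Section ColumnHeights.
Local Open Scope fset_scope.
Local Open Scope nat_scope.

(** The length of the column of index x; the bound of the search lies strictly
below the whole diagram. *)
Definition height (mu : {fset box}) (x : nat) : nat :=
  find (fun y => (x, y) \notin mu) (iota 0 (\max_(b <- mu) b.2).+2).

Lemma mem_height mu x y : ferrers mu -> ((x, y) \in mu) = (y < height mu x).
Proof.
move=> fmu; set N := (\max_(b <- mu) b.2).+1.
have yN b : b \in mu -> b.2 < N.
  move=> h; rewrite ltnS.
  exact: (@leq_bigmax_seq _ (enum_fset mu) predT (fun b : box => b.2)).
have hs : has (fun y => (x, y) \notin mu) (iota 0 N.+1).
  apply/hasP; exists N; first by rewrite mem_iota; lia.
  by apply/negP => /yN /=; rewrite ltnn.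
have lt_find := hs; rewrite has_find size_iota in lt_find.
apply/idP/idP => [h|h].
  rewrite ltnNge; apply/negP => le_y.
  have := nth_find 0 hs; rewrite nth_iota // add0n => /negP; apply.
  by apply: fmu h _ _ => /=.
have := before_find 0 h; rewrite nth_iota ?add0n.
  by move/negbFE.
by apply: ltn_trans h _; apply: lt_find.
Qed.

Lemma height_anti mu x : ferrers mu -> height mu x.+1 <= height mu x.
Proof.
move=> f; rewrite leqNgt; apply/negP; rewrite -mem_height // => h.
have : (x, height mu x) \in mu by apply: f h _ _ => /=.
by rewrite mem_height // ltnn.
Qed.

Lemma ferrers_ext mu nu : ferrers mu -> ferrers nu -> height mu =1 height nu -> mu = nu.
Proof. by move=> fm fn e; apply/fsetP => -[x y]; rewrite !mem_height // e. Qed.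

Lemma height_unique mu h : ferrers mu -> (forall x y, ((x, y) \in mu) = (y < h x)) ->
  height mu =1 h.
Proof.
move=> f e x; apply/eqP; rewrite eqn_leq; apply/andP; split; rewrite leqNgt; apply/negP.
  by rewrite -mem_height // e ltnn.
by rewrite -e mem_height // ltnn.
Qed.

Definition diagram (N : nat) (h : nat -> nat) : {fset box} :=
  [fset b in [seq (x, y) | x <- iota 0 N, y <- iota 0 (h x)]].

Lemma mem_diagram N h x y : ((x, y) \in diagram N h) = (x < N) && (y < h x).
Proof.
rewrite inE; apply/allpairsPdep/andP => [[x' [y' []]]|[hx hy]].
  by rewrite !mem_iota => hx hy [-> ->].
by exists x, y; rewrite !mem_iota.
Qed.

Lemma card_diagram N h : #|` diagram N h| = \sum_(x < N) h x.
Proof.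
rewrite card_fseq undup_id; last first.
  apply: allpairs_uniq_dep => [|x _|]; rewrite ?iota_uniq //.
  by move=> [x y] [x' y'] _ _ /= [-> ->].
rewrite size_allpairs_dep sumnE big_map -{1}[N]subn0 big_mkord.
by apply: eq_bigr => x _; rewrite size_iota.
Qed.

Lemma ferrers_diagram N h : (forall x, h x.+1 <= h x) -> ferrers (diagram N h).
Proof.
move=> hh [x y] [x' y'] /=; rewrite !mem_diagram => /andP[h1 h2] h3 h4.
by have := nonincreasing_le hh h3; lia.
Qed.

Lemma height_diagram N h : (forall x, h x.+1 <= h x) -> (forall x, N <= x -> h x = 0) ->
  height (diagram N h) =1 h.
Proof.
move=> hh h0; apply: height_unique; first exact: ferrers_diagram.
by move=> x y; rewrite mem_diagram; case: (ltnP x N) => // /h0 ->.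
Qed.

Lemma fsubset_size (mu : {fset box}) s : uniq s -> {subset s <= mu} -> size s <= #|` mu|.
Proof. exact: uniq_leq_size. Qed.

Lemma height_le_card mu x : ferrers mu -> height mu x <= #|` mu|.
Proof.
move=> f; rewrite -[height mu x](size_iota 0) -(size_map (pair x)).
apply: fsubset_size; first by rewrite map_inj_uniq ?iota_uniq // => a b [].
by move=> b /mapP[y]; rewrite mem_iota add0n => hy ->; rewrite mem_height.
Qed.

Lemma height_gt0 mu x : ferrers mu -> 0 < height mu x -> x < #|` mu|.
Proof.
move=> f; rewrite -mem_height // => h.
rewrite -[x.+1](size_iota 0) -(size_map (fun z => (z, 0))).
apply: fsubset_size; first by rewrite map_inj_uniq ?iota_uniq // => a b [].
move=> b /mapP[z]; rewrite mem_iota add0n => /andP[_ hz] ->.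
by apply: f h _ _ => //=; rewrite -ltnS.
Qed.

Lemma diagram_height mu N : ferrers mu -> #|` mu| <= N -> mu = diagram N (height mu).
Proof.
move=> f leN; apply/fsetP => -[x y]; rewrite mem_diagram mem_height //.
case: (ltnP x N) => //= Nx; apply/negbTE; rewrite -leqNgt.
by have := height_gt0 (x := x) f; lia.
Qed.

Lemma in_fset_sep (K : choiceType) (A : {fset K}) (P : pred K) x :
  (x \in [fset y in A | P y]) = (x \in A) && P x.
Proof. by rewrite !inE. Qed.

Definition partitions (n : nat) : {fset {fset box}} :=
  [fset mu in fpowerset (diagram n (fun=> n)) | `[< ferrers mu >] && (#|` mu| == n)].

Lemma in_partitions n mu : (mu \in partitions n) <-> ferrers mu /\ #|` mu| = n.
Proof.
rewrite /partitions !inE /=; split; first by move=> /and3P[_ /asboolP f /eqP].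
move=> [f e]; apply/and3P; split; [|exact/asboolP|exact/eqP].
rewrite fpowersetE; apply/fsubsetP => -[x y]; rewrite mem_height // mem_diagram => h.
have := @height_gt0 mu x f; have := @height_le_card mu x f; rewrite e => h1 h2.
by rewrite h2 ?(leq_trans h h1) // (leq_trans _ h).
Qed.

Section Multiplicities.
Variables (J n : nat).

(** The conjugate partition: m j is the multiplicity of the part j + 1, and the
column of index x meets exactly the rows of length larger than x. *)
Definition tails (m : {ffun 'I_J -> 'I_n.+1}) (x : nat) : nat :=
  \sum_(j < J | x <= j) m j.

Lemma tailsS m (j : 'I_J) : tails m j = m j + tails m j.+1.
Proof.
rewrite /tails (bigD1 j) //=; congr (_ + _); apply: eq_bigl => i.
by rewrite -val_eqE /=; lia.
Qed.

Lemma tails_anti m x : tails m x.+1 <= tails m x.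
Proof.
case: (ltnP x J) => [xJ|Jx]; first by rewrite (tailsS m (Ordinal xJ)) leq_addl.
by rewrite /tails big_pred0 // => j; have := ltn_ord j; lia.
Qed.

Lemma tails0 m x : J <= x -> tails m x = 0.
Proof. by move=> Jx; rewrite /tails big_pred0 // => j; have := ltn_ord j; lia. Qed.

Lemma sum_tails m : \sum_(x < J) tails m x = \sum_(j < J) j.+1 * m j.
Proof.
rewrite /tails (exchange_big_dep xpredT) //=; apply: eq_bigr => j _.
under eq_bigl => x do rewrite -ltnS.
by rewrite (big_ord_narrow (ltn_ord j)) sum_nat_const card_ord.
Qed.

(** A partition of n is determined by the multiplicities of its parts, which are
the differences of consecutive column heights. *)
Lemma card_multiplicities (Q : nat -> pred nat) : n <= J ->
  #|[set m : {ffun 'I_J -> 'I_n.+1} |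
       (\sum_(j < J) j.+1 * m j == n) && [forall j : 'I_J, Q j.+1 (m j)]]|
  = #|` [fset mu in partitions n |
          [forall j : 'I_J, Q j.+1 (height mu j - height mu j.+1)]]|.
Proof.
move=> nJ; set S := [set m | _].
pose psi (m : {ffun 'I_J -> 'I_n.+1}) := diagram J (tails m).
have hpsi m : height (psi m) =1 tails m.
  by apply: height_diagram; [apply: tails_anti | apply: tails0].
have psi_m m (j : 'I_J) : height (psi m) j - height (psi m) j.+1 = m j.
  by rewrite !hpsi tailsS addnK.
have -> : [fset mu in partitions n |
     [forall j : 'I_J, Q j.+1 (height mu j - height mu j.+1)]]
   = [fset psi m | m in S].
  apply/fsetP => mu; rewrite in_fset_sep; apply/andP/imfsetP => /=.
    move=> [/in_partitions[f e] /forallP hQ].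
    pose m : {ffun 'I_J -> 'I_n.+1} := 
      [ffun j : 'I_J => inord (height mu j - height mu j.+1)].
    have mE j : m j = height mu j - height mu j.+1 :> nat.
      by rewrite ffunE inordK // ltnS -e; have := @height_le_card mu j f; lia.
    have hm x : tails m x = height mu x.
      have [k] : exists k, J <= x + k by exists J; lia.
      elim: k x => [|k IH] x xk.
        by rewrite tails0; [have := @height_gt0 mu x f | ]; lia.
      case: (ltnP x J) => Jx; last first.
        by rewrite tails0; [have := @height_gt0 mu x f | ]; lia.
      rewrite (tailsS m (Ordinal Jx)) mE /= IH; last by lia.
      by have := @height_anti mu x f; lia.
    have emu : mu = psi m.
      rewrite {1}(@diagram_height mu J f) ?e //; apply/fsetP => -[x y].
      by rewrite !mem_diagram hm.
    exists m => //; rewrite inE -sum_tails -card_diagram -/(psi m) -emu e eqxx /=.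
    by apply/forallP => j; rewrite mE.
  move=> [m]; rewrite inE => /andP[/eqP sm /forallP hQ] ->; split.
    apply/in_partitions; split; first by apply: ferrers_diagram; apply: tails_anti.
    by rewrite card_diagram sum_tails.
  by apply/forallP => j; rewrite psi_m.
rewrite card_in_imfset /=; first by rewrite cardE.
move=> m m' _ _ e; apply/ffunP => j; apply: val_inj => /=.
by rewrite -!psi_m e.
Qed.

End Multiplicities.

End ColumnHeights.

(** * Adding components to a partition *)

Section Placements.
Local Open Scope fset_scope.
Local Open Scope nat_scope.

Section Fit.
Variables (t0 u0 : nat -> nat) (la : {fset box}).
Hypothesis htop : forall x, t0 x.+1 <= t0 x.
Hypothesis hbot : forall x, u0 x.+1 <= u0 x.
Hypothesis mem_la : forall x y, ((x, y) \in la) = (t0 x <= y < u0 x).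

Implicit Types (a : {ffun components la -> nat}) (C : components la).

Definition within a C x := a C <= x < a C + width (val C).

Definition col_height C i := u0 (left_col (val C) + i) - t0 (left_col (val C) + i).

Definition added_height a x := \sum_C if within a C x then col_height C (x - a C) else 0.

(** The boundary of mu contains the north-west path of C translated to start at
column a C. The multiplicity of the part x is height (x-1) - height x; that of
the part 0 is infinite, hence no condition if a C = 0. *)
Definition fits a (mu : {fset box}) : Prop :=
  forall C i, i < width (val C) ->
    if i is i'.+1
    then height mu (a C + i') - height mu (a C + i) = path_mult t0 u0 (left_col (val C)) i
    else 0 < a C ->
      path_mult t0 u0 (left_col (val C)) 0 <= height mu (a C).-1 - height mu (a C).

Definition fills a (mu mu' : {fset box}) : Prop :=
  forall x, height mu' x = height mu x + added_height a x.

Lemma disjoint_intervalsP a : disjoint_intervals a <->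
  forall C C' x, within a C x -> within a C' x -> C = C'.
Proof.
split=> [dis C C' x hx hx'|dis C C' CC'].
  apply/eqP/negPn/negP => CC'; have /fdisjointP/(_ x) := dis _ _ CC'.
  by rewrite !inE !mem_iota; move: hx hx'; rewrite /within => -> -> /(_ isT).
apply/fdisjointP => x; rewrite !inE !mem_iota => hx; apply/negP => hx'.
by case/eqP: CC'; apply: dis hx hx'.
Qed.

Let compP C := components_strip htop hbot mem_la (valP C).
Let wid_gt0 C : 0 < width (val C) := strip_gt0 (compP C).1.
Let comp_col C i : i < width (val C) ->
  t0 (left_col (val C) + i) < u0 (left_col (val C) + i).
Proof. by move=> h; apply: (strip_col (compP C).1); lia. Qed.
Let comp_link C i : i.+1 < width (val C) ->
  t0 (left_col (val C) + i) < u0 (left_col (val C) + i.+1).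
Proof. by move=> h; rewrite addnS; apply: (strip_link (compP C).1); lia. Qed.

Lemma within_left a C : within a C (a C).
Proof. by rewrite /within; have := wid_gt0 C; lia. Qed.

Lemma within_add a C i : within a C (a C + i) = (i < width (val C)).
Proof. by rewrite /within; lia. Qed.

Section Disjoint.
Variable a : {ffun components la -> nat}.
Hypothesis dis : forall C C' x, within a C x -> within a C' x -> C = C'.

Lemma added_height_in C i : i < width (val C) ->
  added_height a (a C + i) = col_height C i.
Proof.
move=> hi; rewrite /added_height (bigD1 C) //= within_add hi addKn.
rewrite big1 ?addn0 // => C' CC'.
by case: ifP => // h; case/eqP: CC'; apply: dis h _; rewrite within_add.
Qed.

Lemma added_height_out x : (forall C, ~~ within a C x) -> added_height a x = 0.
Proof. by move=> h; rewrite /added_height big1 // => C _; rewrite (negbTE (h C)). Qed.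

Variant column_spec x : Prop :=
  | ColumnIn C i of i < width (val C) & x = a C + i
  | ColumnOut of forall C, ~~ within a C x.

Lemma columnP x : column_spec x.
Proof.
have [/existsP[C h]|h] := boolP [exists C, within a C x].
  by apply: (@ColumnIn _ C (x - a C)); move: h; rewrite /within; lia.
by apply: ColumnOut => C; apply/negP => hC; case/existsP: h; exists C.
Qed.

Variable mu : {fset box}.
Hypothesis fmu : ferrers mu.
Hypothesis hfit : fits a mu.

Let h := height mu.
Let u x := h x + added_height a x.

Let h_anti x : h x.+1 <= h x.
Proof. exact: height_anti. Qed.

Let fit0 C : 0 < a C -> u (a C) <= h (a C).-1.
Proof.
move=> a0; have := hfit (wid_gt0 C) a0; have := added_height_in (wid_gt0 C).
rewrite addn0 /u /col_height /path_mult !addn0 -/h => ->.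
have := h_anti (a C).-1; rewrite prednK //; have := comp_col (wid_gt0 C).
by rewrite addn0; lia.
Qed.

Let fitS C i : i.+1 < width (val C) ->
  h (a C + i) + t0 (left_col (val C) + i.+1) = h (a C + i.+1) + t0 (left_col (val C) + i).
Proof.
move=> iL; have := hfit iL; rewrite /path_mult -/h.
by have := h_anti (a C + i); have := htop (left_col (val C) + i); rewrite -!addnS; lia.
Qed.

Let u_in C i : i < width (val C) ->
  u (a C + i) + t0 (left_col (val C) + i) = h (a C + i) + u0 (left_col (val C) + i).
Proof.
by move=> iL; rewrite /u added_height_in // /col_height; have := comp_col iL; lia.
Qed.

(** There is a cut after column x unless x and x+1 lie in the same interval: if
x+1 is the left end of an interval this is the inequality imposed there, and if
x+1 is in no interval nothing is added to its column. *)
Let u_break x : (forall C i, i.+1 < width (val C) -> x != a C + i) -> u x.+1 <= h x.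
Proof.
move=> hx; case: (columnP x.+1) => [C [|i] iL e|out].
- by have := fit0 (C := C); rewrite addn0 in e; rewrite -e => /(_ isT).
- by have := hx C i iL; rewrite addnS in e; case: e => ->; rewrite eqxx.
by rewrite /u added_height_out // addn0.
Qed.

Let u_link C i : i.+1 < width (val C) -> h (a C + i) < u (a C + i.+1).
Proof.
by move=> iL; have := fitS iL; have := u_in iL; have := comp_link iL; lia.
Qed.

Let u_in_anti C i : i.+1 < width (val C) -> u (a C + i.+1) <= u (a C + i).
Proof.
move=> iL; have := u_in iL; have := u_in (ltnW iL); have := fitS iL.
have := hbot (left_col (val C) + i); rewrite -addnS.
lia.
Qed.

Lemma filled_anti x : u x.+1 <= u x.
Proof.
have [/existsP[C /existsP[[i iL] /= /eqP e]]|hx] :=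
  boolP [exists C, [exists i : 'I_(width (val C)).-1, x == a C + i]].
  have iL' : i.+1 < width (val C) by lia.
  by rewrite e -addnS; apply: u_in_anti.
apply: (@leq_trans (h x)); last exact: leq_addr.
apply: u_break => C i iL.
apply: contra hx => e; apply/existsP; exists C; apply/existsP.
have iL' : i < (width (val C)).-1 by lia.
by exists (Ordinal iL').
Qed.

Lemma filled_run C : column_run h u (a C) (width (val C)).
Proof.
have w0 := wid_gt0 C; split => //.
- move=> x hx; have iL : x - a C < width (val C) by lia.
  have := u_in iL; have := comp_col iL; rewrite subnKC; last by lia.
  by lia.
- move=> x ax xL; have iL : (x - a C).+1 < width (val C) by lia.
  by have := u_link iL; rewrite addnS subnKC.
- exact: fit0.
have -> : a C + width (val C) = (a C + width (val C)).-1.+1 by lia.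
apply: u_break => C' i iL; apply/negP => /eqP e.
have CC : C = C'.
  apply: (dis (x := (a C + width (val C)).-1)); first by rewrite /within; lia.
  by rewrite e within_add; lia.
by subst C'; lia.
Qed.

Lemma filled_column x : h x < u x -> exists C, within a C x.
Proof.
case: (columnP x) => [C i iL ->|out]; first by exists C; rewrite within_add.
by rewrite /u added_height_out // addn0 ltnn.
Qed.

(** Along the interval of C the boundary of mu stays at constant distance from
the tops of C. *)
Lemma filled_offset C i : i < width (val C) ->
  h (a C + i) + t0 (left_col (val C)) = t0 (left_col (val C) + i) + h (a C).
Proof.
elim: i => [|i IH] iL; first by rewrite !addn0 addnC.
by have := IH (ltnW iL); have := fitS iL; lia.
Qed.

Variable mu' : {fset box}.
Hypothesis fmu' : ferrers mu'.
Hypothesis hfill : fills a mu mu'.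

Let mem_diff x y : ((x, y) \in mu' `\` mu) = (h x <= y < u x).
Proof. by rewrite inE !mem_height // hfill -leqNgt. Qed.

(** The columns [a C, a C + width C) form a maximal run of mu' minus mu: the
condition at the left end and the monotonicity of the heights of mu cut it off
on both sides. As all added boxes lie in these columns, there is no other
component. *)
Lemma filled_equiv : exists2 f : components la -> components (mu' `\` mu), bijective f &
  forall C, translates (val C) (val (f C)) /\ left_col (val (f C)) = a C.
Proof.
have ex C : exists C' : components (mu' `\` mu),
    left_col (val C') = a C /\ width (val C') = width (val C).
  have [C' hC' e] := column_run_component h_anti filled_anti mem_diff (filled_run C).
  by exists [` hC'].
have ex' C : {C' : components (mu' `\` mu) |
    left_col (val C') = a C /\ width (val C') = width (val C)}.
  exact: cid.
pose f C := sval (ex' C).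
have fP C : left_col (val (f C)) = a C /\ width (val (f C)) = width (val C).
  exact: (svalP (ex' C)).
have shp (C' : components (mu' `\` mu)) :=
  components_strip h_anti filled_anti mem_diff (valP C').
exists f.
  have inj : injective f.
    move=> C C' e; have [e1 _] := fP C; have [e2 _] := fP C'.
    apply: (dis (x := a C)); first exact: within_left.
    by rewrite -e1 e e2 within_left.
  have surj (X : components (mu' `\` mu)) : exists C, f C = X.
    have [sX _] := shp X; have w' := strip_gt0 sX.
    have hX : left_col (val X) <= left_col (val X) < left_col (val X) + width (val X).
      by lia.
    have [C hC] := filled_column (strip_col sX hX); exists C.
    apply: val_inj.
    apply: components_inj h_anti filled_anti mem_diff _ _ _ _ _ _ hX => //.
    - exact: valP.
    - exact: valP.
    by have [-> ->] := fP C.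
  have surj' (X : components (mu' `\` mu)) : {C | f C = X} by apply: cid.
  exists (fun X => sval (surj' X)) => [C|X]; last exact: (svalP (surj' X)).
  by apply: inj; rewrite (svalP (surj' (f C))).
move=> C; have [e1 e2] := fP C; split=> //.
have [sC' _] := shp (f C); apply/(translates_strip (compP C).1 sC'); split=> //.
exists (h (a C)), (t0 (left_col (val C))) => i iL; rewrite e1.
have := filled_offset iL; have := u_in iL.
have := comp_col iL; lia.
Qed.

End Disjoint.

Section Converse.
Variables mu mu' : {fset box}.
Hypotheses (fmu : ferrers mu) (fmu' : ferrers mu') (sub : mu `<=` mu').
Variable f : components la -> components (mu' `\` mu).
Hypothesis f_bij : bijective f.
Hypothesis f_tr : forall C, translates (val C) (val (f C)).

Let h := height mu.
Let u := height mu'.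

Let h_anti x : h x.+1 <= h x. Proof. exact: height_anti. Qed.
Let u_anti x : u x.+1 <= u x. Proof. exact: height_anti. Qed.
Let mem_diff x y : ((x, y) \in mu' `\` mu) = (h x <= y < u x).
Proof. by rewrite inE !mem_height // -leqNgt. Qed.
Let h_le x : h x <= u x.
Proof.
rewrite leqNgt; apply/negP; rewrite -mem_height // => /(fsubsetP sub).
by rewrite mem_height // ltnn.
Qed.

Let shp (C' : components (mu' `\` mu)) :=
  components_strip h_anti u_anti mem_diff (valP C').

Definition left_ends : {ffun components la -> nat} := [ffun C => left_col (val (f C))].

Let width_f C : width (val (f C)) = width (val C).
Proof. by have [/(_ (f_tr C))[-> _] _] := translates_strip (compP C).1 (shp (f C)).1. Qed.

Let profile_f C i : i < width (val C) ->
  u (left_ends C + i) - h (left_ends C + i) = col_height C i /\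
  (i.+1 < width (val C) -> h (left_ends C + i) - h (left_ends C + i.+1)
     = t0 (left_col (val C) + i) - t0 (left_col (val C) + i.+1)).
Proof.
have [/(_ (f_tr C))[_ [p [q hpq]]] _] := translates_strip (compP C).1 (shp (f C)).1.
move=> iL; rewrite /col_height !ffunE; have [e1 e2] := hpq _ iL; split; first by lia.
by move=> /hpq[e3 e4]; lia.
Qed.

Lemma left_ends_dis C C' x : within left_ends C x -> within left_ends C' x -> C = C'.
Proof.
rewrite /within !ffunE -!width_f => hx hx'; apply: (bij_inj f_bij); apply: val_inj.
by apply: components_inj h_anti u_anti mem_diff _ _ _ _ _ hx hx'; apply: valP.
Qed.

Lemma left_ends_fits : fits left_ends mu.
Proof.
move=> C [|i] iL; last first.
  by have [_ /(_ iL)] := profile_f (ltnW iL); rewrite /path_mult -/h.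
have [e _] := profile_f iL; move: e; rewrite /col_height !addn0 /path_mult => <- l0.
have := column_run_left (shp (f C)).2; move: l0; rewrite !ffunE => l0 /(_ l0).
by rewrite -/h; lia.
Qed.

Lemma left_ends_fills : fills left_ends mu mu'.
Proof.
move=> x; rewrite -/h -/u.
case: (@columnP left_ends x) => [C i iL ->|out].
  rewrite (added_height_in left_ends_dis) //; have [<- _] := profile_f iL.
  by rewrite subnKC.
rewrite added_height_out // addn0; apply/eqP; rewrite eq_sym eqn_leq h_le /= leqNgt.
apply/negP => hu.
have [C' hC' hx] := components_cover h_anti u_anti mem_diff hu.
have [g fK gK] := f_bij; have := out (g [` hC']).
by rewrite /within ffunE -width_f gK /= hx.
Qed.

End Converse.

(** At the left end of C the multiplicity of the part a C is positive. This gives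
summability: only finitely many tuples contribute to q^n. *)
Lemma fits_bound a mu C : ferrers mu -> fits a mu -> a C <= #|` mu|.
Proof.
move=> fmu hfit; case: (posnP (a C)) => [-> //|a0].
have := hfit C 0 (wid_gt0 C) a0; have := comp_col (wid_gt0 C).
have := @height_gt0 mu (a C).-1 fmu; rewrite addn0 /path_mult; lia.
Qed.

End Fit.

End Placements.

(** * Counting additions by left ends *)

Section CountingAdditions.
Local Open Scope fset_scope.
Local Open Scope nat_scope.

Lemma card_fset_sep (K : choiceType) (A : {fset K}) (P : pred K) :
  #|` [fset x in A | P x]| = \sum_(x <- A) P x.
Proof.
rewrite card_fset_sum1 -(big_fset_condE _ A P (fun=> 1)) big_mkcond /=.
by apply: eq_bigr => x _; case: (P x).
Qed.

Section Count.
Variables (t0 u0 : nat -> nat) (la : {fset box}).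
Hypothesis htop : forall x, t0 x.+1 <= t0 x.
Hypothesis hbot : forall x, u0 x.+1 <= u0 x.
Hypothesis mem_la : forall x y, ((x, y) \in la) = (t0 x <= y < u0 x).

Implicit Types (a : {ffun components la -> nat}).

Definition same_class : rel (components la) :=
  fun C C' => `[< translates (val C) (val C') >].

Lemma same_class_equiv : equivalence_rel same_class.
Proof.
move=> x y z; split; first by apply/asboolP; apply: translates_refl.
move=> /asboolP h; apply/asboolP/asboolP.
  exact: translates_trans (translates_sym h).
exact: translates_trans h.
Qed.

Lemma card_same_class : #|class_perms same_class| = symmetry_factor la.
Proof. exact: card_class_perms same_class_equiv. Qed.

Definition ord_vals n (b : {ffun components la -> 'I_n.+1}) :
  {ffun components la -> nat} := [ffun C => val (b C)].

Definition tuples (n : nat) : {fset {ffun components la -> nat}} :=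
  [fset a in [fset ord_vals b | b : {ffun components la -> 'I_n.+1}]
   | `[< disjoint_intervals a >]].

Lemma in_tuples n a :
  (a \in tuples n) <-> disjoint_intervals a /\ forall C, a C <= n.
Proof.
rewrite in_fset_sep; split.
  move=> /andP[/imfsetP[b /= _ ->] /asboolP h]; split=> // C.
  by rewrite ffunE -ltnS ltn_ord.
move=> [d h]; apply/andP; split; last exact/asboolP.
apply/imfsetP; exists [ffun C => inord (a C)] => //.
by apply/ffunP => C; rewrite !ffunE /= inordK // ltnS.
Qed.

Definition fits_count a n :=
  #|` [fset mu in partitions n | `[< fits t0 u0 a mu >]]|.

Let fits_fills a mu mu' : bool := `[< fits t0 u0 a mu /\ fills t0 u0 a mu mu' >].

Lemma fills_additions a n mu mu' : disjoint_intervals a ->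
  ferrers mu -> #|` mu| = n -> ferrers mu' -> fits t0 u0 a mu -> fills t0 u0 a mu mu' ->
  additions la n (mu, mu').
Proof.
move=> /disjoint_intervalsP dis fmu en fmu' hfit hfill.
have sub : mu `<=` mu'.
  apply/fsubsetP => -[x y]; rewrite !mem_height // hfill => h.
  by apply: leq_trans h _; apply: leq_addr.
have [f fb ft] := filled_equiv htop hbot mem_la dis fmu hfit fmu' hfill.
have eq : skew_equiv (mu' `\` mu) la.
  have [g fK gK] := fb; exists g; first by exists f.
  by move=> X; apply: translates_sym; have [] := ft (g X); rewrite gK.
split=> //=; rewrite -(skew_equiv_card eq) cardfsDS // en subnKC // -en.
exact: fsubset_leq_card.
Qed.

Lemma exists_filled a mu : disjoint_intervals a -> ferrers mu -> fits t0 u0 a mu ->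
  exists2 mu', ferrers mu' & fills t0 u0 a mu mu'.
Proof.
move=> /disjoint_intervalsP dis fmu hfit.
pose u x := height mu x + added_height t0 u0 a x.
(* From column N on, mu has no box and there is no interval. *)
pose N := #|` mu| + \sum_C (a C + width (val C)).
have u_anti x : u x.+1 <= u x by exact: (filled_anti htop hbot mem_la dis fmu hfit x).
have u_out x : N <= x -> u x = 0.
  move=> Nx; rewrite /u added_height_out.
    rewrite addn0; apply/eqP; rewrite -leqn0 leqNgt; apply/negP => /(height_gt0 fmu).
    by rewrite ltnNge (leq_trans _ Nx) // leq_addr.
  move=> C; rewrite /within; apply/negP => /andP[_]; rewrite ltnNge (leq_trans _ Nx) //.
  by rewrite /N (bigD1 C) //=; lia.
exists (diagram N u); first exact: ferrers_diagram.
by move=> x; rewrite height_diagram.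
Qed.

(** Fix one matching g of the components of la with those of mu' minus mu. The
other matchings are the g \o s for s a permutation of the components of la
preserving the translation classes, and a matching amounts to the tuple of left
ends of the matched components. *)
Lemma fiber_card n mu mu' : mu \in partitions n -> mu' \in partitions (n + #|` la|) ->
  \sum_(a <- tuples n) fits_fills a mu mu'
    = symmetry_factor la * `[< additions la n (mu, mu') >].
Proof.
move=> /in_partitions[fmu en] /in_partitions[fmu' en'].
case: asboolP => [[/= _ sub _ _ [F Fb Ft]]|nadd]; last first.
  rewrite muln0 big_seq big1 // => a /in_tuples[dis _].
  rewrite /fits_fills; case: asboolP => // -[h1 h2]; case: nadd.
  exact: (fills_additions dis fmu en fmu' h1 h2).
rewrite muln1 -card_fset_sep -card_same_class.
have [g FK gK] := Fb.
have gb : bijective g by exists F.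
have Fg C : translates (val C) (val (g C)).
  by apply: translates_sym; have := Ft (g C); rewrite gK.
pose ends (s : {perm components la}) := left_ends (fun C => g (s C)).
have endsP s : s \in class_perms same_class ->
    [/\ forall C C' x, within (ends s) C x -> within (ends s) C' x -> C = C',
        fits t0 u0 (ends s) mu & fills t0 u0 (ends s) mu mu'].
  rewrite inE => /forallP hs.
  have bij : bijective (fun C => g (s C)).
    exact: bij_comp gb (injF_bij (@perm_inj _ s)).
  have tr C : translates (val C) (val (g (s C))).
    by apply: translates_trans (Fg _); apply/asboolP; apply: hs.
  split; first exact: (left_ends_dis htop hbot mem_la fmu fmu' bij tr).
    exact: (left_ends_fits htop hbot mem_la fmu fmu' sub tr).
  exact: (left_ends_fills htop hbot mem_la fmu fmu' sub bij tr).
have -> : [fset a in tuples n | fits_fills a mu mu']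
    = [fset ends s | s in class_perms same_class].
  apply/fsetP => a; rewrite in_fset_sep; apply/andP/imfsetP => /=.
    move=> [/in_tuples[/disjoint_intervalsP dis _] /asboolP[hfit hfill]].
    have [f fb ft] := filled_equiv htop hbot mem_la dis fmu hfit fmu' hfill.
    have inj : injective (fun C => F (f C)) by apply: inj_comp (bij_inj Fb) (bij_inj fb).
    exists (perm inj).
      rewrite inE; apply/forallP => C; rewrite permE; apply/asboolP.
      by apply: translates_trans (Ft _); have [] := ft C.
    apply/ffunP => C; rewrite /ends /left_ends ffunE permE FK.
    by have [] := ft C.
  move=> [s hs ->]; have [h1 h2 h3] := endsP s hs; split; last exact/asboolP.
  apply/in_tuples; split; first exact/disjoint_intervalsP.
  by move=> C; rewrite -en; apply: (fits_bound htop hbot mem_la C fmu h2).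
rewrite card_in_imfset /=; first by rewrite cardE.
move=> s s' _ _ e; apply/perm.permP => C.
have := congr1 (fun a : {ffun components la -> nat} => a C) e.
rewrite /ends /left_ends !ffunE => e'.
apply: (bij_inj gb); apply: val_inj.
have mem_diff x y : ((x, y) \in mu' `\` mu) = (height mu x <= y < height mu' x).
  by rewrite inE !mem_height // -leqNgt.
apply: (components_left_col_inj (fun x => height_anti x fmu)
  (fun x => height_anti x fmu') mem_diff _ _ e'); exact: valP.
Qed.

Lemma additions_partitions n mu mu' : additions la n (mu, mu') ->
  mu \in partitions n /\ mu' \in partitions (n + #|` la|).
Proof. by case=> /= -[f f'] _ e e' _; split; apply/in_partitions. Qed.

Lemma A_sum n : A_ n la = \sum_(mu <- partitions n) \sum_(mu' <- partitions (n + #|` la|))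
  `[< additions la n (mu, mu') >].
Proof.
pose s := [seq (mu, mu') | mu <- partitions n, mu' <- partitions (n + #|` la|)].
have ms p : additions la n p -> p \in s.
  by case: p => mu mu' /additions_partitions[h h']; apply/allpairsP; exists (mu, mu').
have fin : finite_set (additions la n).
  apply: (@sub_finite_set _ _ [set` [fset p in s]]%classic); last exact: finite_fset.
  by move=> p /ms ps; rewrite /= inE.
transitivity (\sum_(p <- s) (`[< additions la n p >] : nat));
  last by rewrite big_allpairs.
rewrite /A_ card_fset_sum1.
rewrite [RHS](eq_bigr (fun p => if `[< additions la n p >] then 1 else 0)); last first.
  by move=> p _; case: ifP.
rewrite -big_mkcond -[RHS]big_filter; apply: perm_big; apply: uniq_perm.
- exact: fset_uniq.
- by rewrite filter_uniq // allpairs_uniq ?fset_uniq // => -[? ?] [? ?].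
move=> p; rewrite in_fset_set // mem_filter; apply/idP/andP.
  move=> /set_mem h; split; last exact: ms. by apply/asboolP.
by move=> [/asboolP h _]; apply: mem_set.
Qed.

(** Double counting of the triples (a, mu, mu') such that the components of la,
placed on mu at the left ends a, fill mu' minus mu: mu' is determined by a and
mu, and [fiber_card] counts the a for given mu and mu'. *)
Lemma sum_fits_count n :
  \sum_(a <- tuples n) fits_count a n = symmetry_factor la * A_ n la.
Proof.
rewrite A_sum big_distrr /=.
under eq_bigr => a _ do rewrite /fits_count card_fset_sep.
rewrite exchange_big /= big_seq [RHS]big_seq; apply: eq_bigr => mu hmu.
have [fmu en] := (in_partitions n mu).1 hmu.
rewrite big_distrr /= [RHS]big_seq.
under [RHS]eq_bigr => mu' hmu' do rewrite -(fiber_card hmu hmu').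
rewrite -big_seq exchange_big /= big_seq [RHS]big_seq.
apply: eq_bigr => a /in_tuples[dis _].
case: asboolP => [hfit|nfit]; last first.
  by rewrite big1 // => mu' _; rewrite /fits_fills; case: asboolP => // -[].
have [mu' fmu' hfill] := exists_filled dis fmu hfit.
have [_ hmu'] := additions_partitions (fills_additions dis fmu en fmu' hfit hfill).
rewrite (bigD1_seq mu') ?fset_uniq //= big_seq_cond big1 ?addn0 => [|nu /andP[hnu ne]].
  by rewrite /fits_fills; case: asboolP => // -[].
rewrite /fits_fills; case: asboolP => // -[_ hfill']; case/eqP: ne.
have [fnu _] := (in_partitions _ nu).1 hnu.
by apply: ferrers_ext => // x; rewrite hfill hfill'.
Qed.

End Count.

End CountingAdditions.

(** * Evaluation of the summands *)

Section Summands.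
Local Open Scope fset_scope.
Local Open Scope nat_scope.

Section Evaluation.
Variables (t0 u0 : nat -> nat) (la : {fset box}).
Hypothesis htop : forall x, t0 x.+1 <= t0 x.
Hypothesis hbot : forall x, u0 x.+1 <= u0 x.
Hypothesis mem_la : forall x y, ((x, y) \in la) = (t0 x <= y < u0 x).
Hypothesis la_gt0 : 1 <= #|` la|.

Let D := #|` la|.

Lemma column_le_card x : u0 x - t0 x <= #|` la|.
Proof.
rewrite -[X in X <= _](size_iota (t0 x)) -(size_map (pair x)).
apply: fsubset_size; first by rewrite map_inj_uniq ?iota_uniq // => i j [].
move=> b /mapP[y]; rewrite mem_iota => hy ->; rewrite mem_la.
move: hy; case: (leqP (t0 x) (u0 x)) => tu; first by rewrite subnKC.
by rewrite (eqP (ltnW tu)) addn0; lia.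
Qed.

Let shp (C : components la) := (components_strip htop hbot mem_la (valP C)).1.

(** The column i is at least that long: the bottom of column i lies strictly below
the top of column i - 1, by the link between them. *)
Lemma path_mult_le_card (C : components la) i : i < width (val C) ->
  path_mult t0 u0 (left_col (val C)) i + ~~ (i == 0) <= D.
Proof.
move=> iL; have cl := @column_le_card (left_col (val C) + i).
rewrite /D /path_mult; case: i iL cl => [|i] iL cl; first by move: cl; rewrite !addn0.
apply: leq_trans cl; rewrite [~~ _]/= addn1.
have := strip_link (shp C) (x := left_col (val C) + i); rewrite -!addnS.
have := htop (left_col (val C) + i); rewrite -addnS.
lia.
Qed.

Section At.
Variables (a : {ffun components la -> nat}) (J : nat).
Hypothesis dis : forall C C' x, within a C x -> within a C' x -> C = C'.
Hypothesis DJ : D <= J.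
Hypothesis aJ : forall C : components la, a C + width (val C) <= J.+1.

Definition column_ok (j : nat) : pred nat := fun m =>
  [forall C : components la, forall i : 'I_(width (val C)), (a C + i == j) ==>
     (if i == 0 :> nat then path_mult t0 u0 (left_col (val C)) 0 <= m
      else m == path_mult t0 u0 (left_col (val C)) i)].

Let idx : seq (components la * nat) :=
  [seq (C, i) | C <- index_enum (components la), i <- iota 0 (width (val C))].

Let col (p : components la * nat) := a p.1 + p.2.

Let o (p : components la * nat) : ypoly J :=
  column_op J (col p) (path_mult t0 u0 (left_col (val p.1)) p.2) (p.2 == 0).

Let mem_idx p : (p \in idx) = (p.2 < width (val p.1)).
Proof.
apply/allpairsPdep/idP => [[C [i [_]]]|h].
  by rewrite mem_iota => hi ->.
by exists p.1, p.2; rewrite mem_iota -surjective_pairing mem_index_enum.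
Qed.

Let idx_uniq : uniq idx.
Proof.
apply: allpairs_uniq_dep => [|C _|]; rewrite ?iota_uniq ?index_enum_uniq //.
by move=> [C i] [C' i'] _ _ /= [-> ->].
Qed.

Let col_inj p q : p \in idx -> q \in idx -> col p = col q -> p = q.
Proof.
case: p q => [C i] [C' i']; rewrite !mem_idx /col /= => hi hi' e.
have CC : C = C' by apply: (dis (x := a C + i)); rewrite ?within_add // e within_add.
by subst C'; congr pair; apply/eqP; rewrite -(eqn_add2l (a C)) e.
Qed.

Let ops_idx : (\prod_(C : components la) S_ J (nw_path (val C)) (a C)
  = \prod_(p <- idx) o p)%R.
Proof.
rewrite big_allpairs_dep; apply: eq_bigr => C _.
by rewrite (S_strip (shp C)) -[X in iota 0 X]subn0 big_mkord.
Qed.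

(** By disjointness at most one factor of the operator acts on the variables of
index j. *)
Lemma at_one_column j : j <= J ->
  at_one (dapply (\prod_(p <- idx | col p == j) o p)%R (factor D J j))
    = if j == 0 then 1%R else part_series j (column_ok j).
Proof.
move=> jJ; case: (@columnP la a j) => [C i iL e|out].
  have hp : (C, i) \in idx by rewrite mem_idx.
  rewrite big_mkcond (bigD1_seq (C, i)) //= {1}/col /= -e eqxx.
  rewrite big_seq_cond big1 => [|q]; last first.
    move=> /andP[qi qn]; case: eqP => // eq; case/eqP: qn.
    by apply: col_inj => //; rewrite eq e.
  rewrite mulr1 /o /= {1}/col /= -e at_one_column_op_factor //.
  - case: eqP => // _; apply: eq_part_series => m; apply/idP/forallP.
      move=> h C'; apply/forallP => i'; apply/implyP => /eqP e'.
      have [eC ei] : (C', val i') = (C, i).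
        by apply: col_inj; rewrite ?mem_idx //= /col /= e'.
      by subst C'; rewrite ei; case: eqP h => // ->.
    move=> /(_ C) /forallP /(_ (Ordinal iL)) /=; rewrite e eqxx /=.
    by case: eqP => [->|].
  - exact: path_mult_le_card.
  - move=> /eqP ->; rewrite /path_mult subn_gt0; apply: (strip_col (shp C)).
    by rewrite leqnn /= -[X in X < _]addn0 ltn_add2l; apply: (strip_gt0 (shp C)).
  - by rewrite e; case: (i) => [|k]; rewrite ?addn1 ?addnS.
rewrite big_seq_cond big_pred0 => [|[C i]]; last first.
  rewrite mem_idx /=; apply/negP => /andP[iL /eqP e].
  by have := out C; rewrite -e within_add iL.
rewrite dapply1 at_one_factor //; case: eqP => // _; apply: eq_part_series => m.
apply/esym/forallP => C; apply/forallP => i; apply/implyP => /eqP e.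
by have := out C; rewrite -e within_add ltn_ord.
Qed.

(** This holds as soon as the cut-off J exceeds n, D and all the intervals, so it
computes the limit of the coefficients for J to infinity. *)
Lemma coefs_T_summand n : n <= J ->
  coefs (at_one (dapply (T_summand J a) (F_ D J))) n
    = ((symmetry_factor la)%:R^-1 * (fits_count t0 u0 a n)%:R)%R.
Proof.
move=> nJ; rewrite /T_summand dapplyZ at_oneZ coefsCM ops_idx F_factor; congr (_ * _)%R.
rewrite (dapply_prod (col := col)); first last.
- move=> [C i] j; rewrite mem_idx mem_iota add0n ltnS => /= iL jJ jc.
  apply: column_op_factor_eq0 => //; last exact: path_mult_le_card.
  by have := aJ C; rewrite /col /=; lia.
- by move=> p _; apply: derivation_column_op.
- move=> [C i]; rewrite mem_idx mem_iota /col /= => iL.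
  by have /= := aJ C; lia.
- exact: iota_uniq.
rewrite at_one_prod big_seq.
under eq_bigr => j.
  rewrite mem_iota add0n ltnS => /andP[_ jJ]; rewrite at_one_column //.
over.
rewrite -big_seq coefs_prod_part_series card_multiplicities // /fits_count.
congr (#|` _|%:R)%R; apply/fsetP => mu.
rewrite ![mu \in [fset _ in _ | _]]in_fset_sep; congr (_ && _). apply/forallP/asboolP.
  move=> h C [|i] iL.
    move=> a0; have aCJ : (a C).-1 < J by have := aJ C; lia.
    have /forallP/(_ C)/forallP/(_ (Ordinal iL)) := h (Ordinal aCJ).
    by rewrite /= prednK // addn0 eqxx.
  have aCJ : a C + i < J by have := aJ C; lia.
  have /forallP/(_ C)/forallP/(_ (Ordinal iL)) := h (Ordinal aCJ).
  by rewrite /= addnS eqxx => /eqP.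
move=> hfit j; apply/forallP => C; apply/forallP => -[[|i] iL]; apply/implyP => /= /eqP e.
  by have := hfit C 0 iL; rewrite addn0 in e; rewrite e; apply.
by have := hfit C i.+1 iL; rewrite addnS in e *; case: e => -> ->.
Qed.

End At.

Lemma fits_count_eq0 a n : disjoint_intervals a -> a \notin tuples la n ->
  fits_count t0 u0 a n = 0.
Proof.
move=> dis an; rewrite /fits_count card_fset_sep big_seq.
rewrite big1 // => mu /in_partitions[fmu en].
case: asboolP => // hfit; case/negP: an; apply/in_tuples; split=> // C.
by rewrite -en; apply: (fits_bound htop hbot mem_la C fmu hfit).
Qed.

Lemma symmetry_factor_gt0 : 0 < symmetry_factor la.
Proof. by apply: prodn_gt0 => B; apply: fact_gt0. Qed.

Lemma skew_TF_at_one :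
  TF_at_one D la (fps_map (fun c : int => (c%:~R)%R : rat) (FZ la)).
Proof.
exists (fun a => Fps (fun n => (symmetry_factor la)%:R^-1 * (fits_count t0 u0 a n)%:R))%R.
  move=> a /disjoint_intervalsP dis n.
  exists (n + D + \sum_C (a C + width (val C))) => J hJ.
  rewrite coefs_T_summand //; [lia| |lia].
  by move=> C; move: hJ; rewrite (bigD1 C) //=; lia.
move=> n; exists (tuples la n); split.
- by move=> a /in_tuples[].
- by move=> a dis an /=; rewrite fits_count_eq0 // mulr0.
rewrite /= -mulr_sumr -natr_sum (sum_fits_count htop hbot mem_la) natrM mulKf //.
by rewrite Num.Theory.pnatr_eq0 -lt0n symmetry_factor_gt0.
Qed.

End Evaluation.

End Summands.

Unset Implicit Arguments.

Theorem theorem7p10 (D : nat) (hD : (1 <= D)%N) (la : {fset box})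
    (hskew : skew_ferrers la) (hsize : #|` la|%fset = D) :
  TF_at_one D la (fps_map (fun c : int => (c%:~R)%R : rat) (FZ la)).
Proof.
have [mu [nu [fmu fnu e]]] := hskew; rewrite -hsize.
apply: (@skew_TF_at_one (height nu) (height mu)) => [x|x|x y|].
- exact: height_anti.
- exact: height_anti.
- by rewrite e inE !mem_height // -leqNgt.
by rewrite hsize.
Qed.
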